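(* Let $K$ be a field, $S=K[x_1,\ldots,x_n]$, and let $I\subset S$ be an equigenerated monomial ideal. Suppose that the fiber cone $F(I)$ is Cohen--Macaulay. Then $I$ is Freiman if and only if $F(I)$ has minimal multiplicity. For example, this is the case (i.e. these equivalent conditions hold) if $F(I)$ is a hypersurface ring defined by a quadratic polynomial.
   Context: $\mathfrak m=(x_1,\ldots,x_n)$. For a graded ideal $I\subset S$, $\mu(I)$ denotes the minimal number of generators of $I$; the fiber cone is the standard graded $K$-algebra $F(I)=\bigoplus_{k\ge 0} I^k/\mathfrak m I^k$, and the analytic spread $\ell(I)$ is the Krull dimension of $F(I)$. An ideal is equigenerated if all elements of a minimal set of generators have the same degree. An equigenerated monomial ideal $I$ is called Freiman if $\mu(I^2)=\ell(I)\mu(I)-\binom{\ell(I)}{2}$. For a standard graded $K$-algebra $R$, $e(R)$ denotes its multiplicity and $\operatorname{embdim}(R)=\dim_K R_1$ its embedding dimension; $R$ has minimal multiplicity if $\operatorname{embdim}(R)=e(R)+\dim R-1$. ''$F(I)$ is a hypersurface ring defined by a quadratic polynomial'' means $F(I)\cong T/(q)$ as graded algebras, with $T$ a standard graded polynomial ring over $K$ and $q\ne 0$ a homogeneous polynomial of degree $2$. *)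

(* Defs.v *)
From HB Require Import structures.
From mathcomp Require Import all_boot all_order all_algebra.
From mathcomp Require Import generic_quotient ring_quotient.
From mathcomp Require Import boolp classical_sets.
From mathcomp Require Import freeg mpoly.

Set Implicit Arguments.
Unset Strict Implicit.
Unset Printing Implicit Defensive.

Import GRing.Theory.
Local Open Scope classical_set_scope.
Local Open Scope quotient_scope.
Local Open Scope ring_scope.

(* Both default to 0 when there is no extremal element. *)
Definition nat_max (P : nat -> Prop) : nat :=
  xget 0%N [set d | P d /\ forall e, P e -> (e <= d)%N].

Definition nat_min (P : nat -> Prop) : nat :=
  xget 0%N [set d | P d /\ forall e, P e -> (d <= e)%N].

Section Ideals.
Variable R : comNzRingType.
Implicit Types (A I J P : set R) (xs : seq R).

(* Unlike [idealr_closed], this allows the unit ideal. *)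
Definition is_ideal I : Prop :=
  [/\ I 0, (forall a b, I a -> I b -> I (a + b)) & forall r a, I a -> I (r * a)].

Definition ideal_gen A : set R :=
  [set x | exists2 s : seq (R * R), (forall u, u \in s -> A u.2) &
                                    x = \sum_(u <- s) u.1 * u.2].

Definition ideal_mul I J : set R :=
  ideal_gen [set x | exists a b, [/\ I a, J b & x = a * b]].

Definition ideal_exp I k : set R := iter k (ideal_mul I) setT.

Definition num_gen I : nat :=
  nat_min (fun d => exists2 s : seq R, size s = d & I = ideal_gen [set` s]).

Definition minimal_generators I (s : seq R) : Prop :=
  I = ideal_gen [set` s] /\
  forall t : seq R, {subset t <= s} -> I = ideal_gen [set` t] ->
    {subset s <= t}.

Definition is_prime_ideal P : Prop :=
  [/\ is_ideal P, ~ P 1 & forall a b, P (a * b) -> P a \/ P b].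

Definition krull_dim : nat :=
  nat_max (fun d => exists P : nat -> set R,
    (forall i, (i <= d)%N -> is_prime_ideal (P i)) /\
    (forall i, (i < d)%N -> P i `<` P i.+1)).

Definition regular_sequence xs : Prop :=
  (forall i, (i < size xs)%N -> forall a,
     ideal_gen [set` take i xs] (xs`_i * a) -> ideal_gen [set` take i xs] a) /\
  ideal_gen [set` xs] <> setT.

Lemma ideal_gen_ideal A : is_ideal (ideal_gen A).
Proof.
split.
- by exists [::] => //; rewrite big_nil.
- move=> a b [s sA ->] [t tA ->]; exists (s ++ t); last by rewrite big_cat.
  by move=> u; rewrite mem_cat => /orP[/sA|/tA].
- move=> r a [s sA ->]; exists [seq (r * u.1, u.2) | u <- s].
    by move=> u /mapP[v vs ->]; exact: (sA _ vs).
  by rewrite big_map mulr_sumr; apply: eq_bigr => u _; rewrite mulrA.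
Qed.

Lemma ideal_gen_sub A x : A x -> ideal_gen A x.
Proof.
move=> Ax; exists [:: (1, x)]; last by rewrite big_seq1 mul1r.
by move=> u; rewrite inE => /eqP ->.
Qed.

Lemma ideal_gen_min A I : is_ideal I -> A `<=` I -> ideal_gen A `<=` I.
Proof.
case=> I0 ID IM AI x [s + ->]; elim: s => [|u s IHs] sA; first by rewrite big_nil.
rewrite big_cons; apply: ID; first by apply/IM/AI/sA; rewrite mem_head.
by apply: IHs => v vs; apply: sA; rewrite inE vs orbT.
Qed.

Lemma ideal_exp_ideal I k : is_ideal (ideal_exp I k).
Proof. by case: k => [|k]; [split | exact: ideal_gen_ideal]. Qed.

Lemma ideal_expD I i j a b :
  ideal_exp I i a -> ideal_exp I j b -> ideal_exp I (i + j)%N (a * b).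
Proof.
move=> + jb; elim: i a => [|i IHi] a.
  by have [_ _ EM] := ideal_exp_ideal I j; move=> _; exact: EM.
have [E0 ED EM] := ideal_exp_ideal I (i.+1 + j).
suff: ideal_exp I i.+1 `<=` [set x | ideal_exp I (i.+1 + j)%N (x * b)] by move/(_ a).
apply: ideal_gen_min.
  split=> [|x y xE yE|r x xE] /=; first by rewrite mul0r.
    by rewrite mulrDl; exact: ED.
  by rewrite -mulrA; exact: EM.
move=> _ [x [y [Ix yE ->]]]; rewrite /= -mulrA; apply: ideal_gen_sub.
by exists x, (y * b); split=> //; exact: IHi.
Qed.

End Ideals.

(* A graded K-algebra is a commutative K-algebra A together with its family
   G of homogeneous components. *)
Section GradedAlgebras.
Variable K : fieldType.

Definition is_basis (V : lmodType K) (W : set V) d (v : 'I_d -> V) : Prop :=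
  [/\ forall i, W (v i),
      forall c : 'I_d -> K, \sum_i c i *: v i = 0 -> forall i, c i = 0
    & forall x, W x -> exists c : 'I_d -> K, x = \sum_i c i *: v i].

(* 0 when W has no finite basis. *)
Definition dim_of (V : lmodType K) (W : set V) : nat :=
  xget 0%N [set d | exists v : 'I_d -> V, is_basis W v].

Variables (A : comAlgType K) (G : nat -> set A).

Definition hilbert_function k : nat := dim_of (G k).

Definition embdim : nat := hilbert_function 1.

Definition hilbert_polynomial : {poly rat} :=
  xget 0 [set P | exists N, forall k, (N <= k)%N ->
                    (hilbert_function k)%:R = P.[k%:R]].

(* In dimension d > 0 the Hilbert polynomial has degree d - 1 and leading
   coefficient e / (d - 1)!; in dimension 0, e is the length. *)
Definition multiplicity : rat :=
  if krull_dim A is d.+1 then d`!%:R * lead_coef hilbert_polynomial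
  else (dim_of [set: A])%:R.

Definition minimal_multiplicity : Prop :=
  embdim%:R = multiplicity + (krull_dim A)%:R - 1.

(* As usual for standard graded algebras, depth and Cohen-Macaulayness are
   taken with respect to the graded maximal ideal. *)
Definition irrelevant_ideal : set A :=
  ideal_gen [set x | exists2 k, (0 < k)%N & G k x].

Definition depth : nat :=
  nat_max (fun d => exists xs : seq A,
    [/\ size xs = d, [set` xs] `<=` irrelevant_ideal & regular_sequence xs]).

Definition cohen_macaulay : Prop := depth = krull_dim A.

End GradedAlgebras.

Definition graded_iso (K : fieldType) (A B : comAlgType K)
    (G : nat -> set A) (H : nat -> set B) : Prop :=
  exists f : {lrmorphism A -> B},
    bijective f /\ forall k x, G k x <-> H k (f x).

Section Quotient.
Variables (K : fieldType) (A : comAlgType K) (J : idealr A).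

Definition alg_quot : Type := {ideal_quot J}.
HB.instance Definition _ := GRing.ComNzRing.on alg_quot.

Definition alg_quot_scale (c : K) (x : alg_quot) : alg_quot :=
  \pi_({ideal_quot J}) (c *: repr x).

Lemma alg_quot_scale_pi c (a : A) :
  alg_quot_scale c (\pi_({ideal_quot J}) a) = \pi_({ideal_quot J}) (c *: a).
Proof.
apply/eqP; rewrite -Quotient.idealrBE -scalerBr -mulr_algl; apply: idealMr.
by rewrite Quotient.idealrBE reprK.
Qed.

Local Notation pi := (\pi_({ideal_quot J})).

Fact alg_quot_scaleA a b x :
  alg_quot_scale a (alg_quot_scale b x) = alg_quot_scale (a * b) x.
Proof. by rewrite -[x]reprK !(alg_quot_scale_pi _ (repr x)) alg_quot_scale_pi scalerA. Qed.

Fact alg_quot_scale1 : left_id 1 alg_quot_scale.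
Proof. by move=> x; rewrite -[x]reprK alg_quot_scale_pi scale1r. Qed.

Fact alg_quot_scaleDr : right_distributive alg_quot_scale +%R.
Proof.
move=> c x y; rewrite -[x]reprK -[y]reprK.
by rewrite -[LHS]/(alg_quot_scale c (pi _ + pi _)) -rmorphD !alg_quot_scale_pi
  scalerDr rmorphD.
Qed.

Fact alg_quot_scaleDl x : {morph alg_quot_scale^~ x : a b / a + b}.
Proof.
by move=> a b; rewrite -[x]reprK !alg_quot_scale_pi scalerDl rmorphD.
Qed.

HB.instance Definition _ := GRing.Zmodule_isLmodule.Build K alg_quot
  alg_quot_scaleA alg_quot_scale1 alg_quot_scaleDr alg_quot_scaleDl.

Fact alg_quot_scaleAl (c : K) (x y : alg_quot) : c *: (x * y) = c *: x * y.
Proof.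
rewrite -[x]reprK -[y]reprK.
rewrite -[LHS]/(alg_quot_scale c (pi _ * pi _)) -rmorphM.
rewrite -[RHS]/(alg_quot_scale c (pi _) * pi _) !alg_quot_scale_pi -rmorphM.
by rewrite scalerAl.
Qed.

HB.instance Definition _ :=
  GRing.Lmodule_isLalgebra.Build K alg_quot alg_quot_scaleAl.
HB.instance Definition _ := GRing.Lalgebra_isComAlgebra.Build K alg_quot.

Definition quot_grading (G : nat -> set A) : nat -> set alg_quot :=
  fun k => [set (\pi_({ideal_quot J}) a : alg_quot) | a in G k].

End Quotient.
Arguments quot_grading {K A} J G k.

Section FiberCone.
Variables (K : fieldType) (n : nat).
Local Notation S := {mpoly K[n]}.
Implicit Type I : set S.

Definition monomial_ideal I : Prop :=
  exists M : set 'X_{1..n}, I = ideal_gen [set 'X_[m] | m in M].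

Definition equigenerated I : Prop :=
  exists (s : seq S) (d : nat),
    minimal_generators I s /\ {in s, forall f, f \is d.-homog}.

Definition max_ideal : set S := ideal_gen (range (fun i : 'I_n => 'X_i)).

(* F(I) is constructed as R(I) / m R(I), where R(I), the sum of the I^k t^k,
   is the Rees algebra inside S[t]; its component of degree k is the image of
   I^k t^k, that is I^k / m I^k. *)
Definition rees_pred I : {pred {poly S}} :=
  fun p => `[< forall k, ideal_exp I k p`_k >].

Fact rees_subring I : subring_closed (rees_pred I).
Proof.
split=> [|p q /asboolP pR /asboolP qR|p q /asboolP pR /asboolP qR]; apply/asboolP => k.
- rewrite coef1; case: k => [//|k] /=; by have [] := ideal_exp_ideal I k.+1.
- have [_ ED EM] := ideal_exp_ideal I k.
  by rewrite coefB -mulN1r; apply: ED => //; apply: EM.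
have [E0 ED EM] := ideal_exp_ideal I k.
rewrite coefM; apply: (big_ind (ideal_exp I k)) => // i _.
by rewrite -[k in ideal_exp I k](subnKC (ltn_ord i : i <= k)%N); exact: ideal_expD.
Qed.

HB.instance Definition _ I :=
  GRing.isSubringClosed.Build {poly S} (rees_pred I) (rees_subring I).

Record rees I := Rees { rees_val : {poly S}; _ : rees_val \in rees_pred I }.

HB.instance Definition _ I := [isSub for @rees_val I].
HB.instance Definition _ I := [Choice of rees I by <:].
HB.instance Definition _ I := [SubChoice_isSubComNzRing of rees I by <:].

Fact rees_scale_subproof I (c : K) (p : rees I) :
  c%:MP *: rees_val p \in rees_pred I.
Proof.
case: p => p /= /asboolP pR; apply/asboolP => k; rewrite coefZ.
by have [_ _] := ideal_exp_ideal I k; apply.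
Qed.

Definition rees_scale I (c : K) (p : rees I) : rees I :=
  Rees (rees_scale_subproof c p).

Fact rees_scaleA I a b (p : rees I) :
  rees_scale a (rees_scale b p) = rees_scale (a * b) p.
Proof. by apply: val_inj; rewrite /= scalerA mpolyCM. Qed.

Fact rees_scale1 I : left_id 1 (@rees_scale I).
Proof. by move=> p; apply: val_inj; rewrite /= scale1r. Qed.

Fact rees_scaleDr I : right_distributive (@rees_scale I) +%R.
Proof. by move=> c p q; apply: val_inj; rewrite /= scalerDr. Qed.

Fact rees_scaleDl I (p : rees I) : {morph (@rees_scale I)^~ p : a b / a + b}.
Proof. by move=> a b; apply: val_inj; rewrite /= mpolyCD scalerDl. Qed.

HB.instance Definition _ I := GRing.Zmodule_isLmodule.Build K (rees I)
  (@rees_scaleA I) (@rees_scale1 I) (@rees_scaleDr I) (@rees_scaleDl I).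

Fact rees_scaleAl I (c : K) (p q : rees I) : c *: (p * q) = c *: p * q.
Proof. by apply: val_inj; rewrite /= scalerAl. Qed.

HB.instance Definition _ I :=
  GRing.Lmodule_isLalgebra.Build K (rees I) (@rees_scaleAl I).
HB.instance Definition _ I := GRing.Lalgebra_isComAlgebra.Build K (rees I).

Definition rees_grading I k : set (rees I) :=
  [set p | forall j, j != k -> (rees_val p)`_j = 0].

Definition max_rees I : {pred rees I} :=
  fun p => `[< forall k, ideal_mul max_ideal (ideal_exp I k) (rees_val p)`_k >].

Fact max_rees_idealr I : idealr_closed (@max_rees I).
Proof.
have Eid k := ideal_gen_ideal [set x | exists a b : S,
  [/\ max_ideal a, ideal_exp I k b & x = a * b]].
split.
- by apply/asboolP => k; rewrite coef0; have [] := Eid k.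
- apply/asboolP => /(_ 0%N); rewrite coef1 /=.
  suff sub: ideal_mul max_ideal (ideal_exp I 0) `<=` [set p | p@_0%MM = 0].
    by move=> /sub /=; rewrite mcoeff1 eqxx; apply/eqP/oner_neq0.
  have id0: is_ideal [set p : S | p@_0%MM = 0].
    split=> [|p q p0 q0|r p p0] /=; first by rewrite mcoeff0.
      by rewrite mcoeffD p0 q0 addr0.
    by rewrite -[_@__]/(mcoeff _ _) rmorphM /= p0 mulr0.
  apply: ideal_gen_min => // _ [a [b [am _ ->]]].
  case: (id0) => _ _ idM; rewrite mulrC; apply: idM; move: a am.
  apply: ideal_gen_min => // _ [i _ <-] /=.
  by rewrite mcoeffX; case: eqP => // /(congr1 mdeg); rewrite mdeg1 mdeg0.
- move=> a p q /asboolP pM /asboolP qM; apply/asboolP => k.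
  have [E0 ED EM] := Eid k; rewrite coefD; apply: (ED); last exact: qM.
  rewrite coefM; apply: (big_ind (ideal_mul max_ideal (ideal_exp I k))) => // i _.
  have ai: ideal_exp I i (rees_val a)`_i by case: (a) => ? /= /asboolP.
  move: (pM (k - i)%N).
  have idk: is_ideal [set x | ideal_mul max_ideal (ideal_exp I k) ((rees_val a)`_i * x)].
    split=> [|x y xE yE|r x xE] /=; first by rewrite mulr0.
      by rewrite mulrDr; exact: ED.
    by rewrite mulrCA; exact: EM.
  suff: ideal_mul max_ideal (ideal_exp I (k - i)) `<=`
    [set x | ideal_mul max_ideal (ideal_exp I k) ((rees_val a)`_i * x)]
    by move/(_ (rees_val p)`_(k - i)).
  apply: ideal_gen_min => // _ [x [y [xm yI ->]]] /=; rewrite mulrCA.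
  apply: ideal_gen_sub; exists x, ((rees_val a)`_i * y); split=> //.
  by rewrite -[k in ideal_exp I k](subnKC (ltn_ord i : i <= k)%N); exact: ideal_expD.
Qed.

HB.instance Definition _ I :=
  isIdealr.Build (rees I) (@max_rees I) (@max_rees_idealr I).

Definition fiber_cone I : comAlgType K := alg_quot (@max_rees I).

Definition fiber_grading I : nat -> set (fiber_cone I) :=
  quot_grading (@max_rees I) (@rees_grading I).

Definition analytic_spread I : nat := krull_dim (fiber_cone I).

Definition freiman I : Prop :=
  (num_gen (ideal_exp I 2))%:Z =
    (analytic_spread I)%:Z * (num_gen I)%:Z - 'C(analytic_spread I, 2)%:Z.

End FiberCone.
Arguments fiber_grading {K n} I k.

Section Quadric.
Variables (K : fieldType) (m : nat).

Record quadric := Quadric {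
  quadric_poly : {mpoly K[m]};
  quadric_neq0 : quadric_poly != 0;
  quadric_homog : quadric_poly \is 2.-homog }.

Definition quadric_ideal (q : quadric) : {pred {mpoly K[m]}} :=
  fun p => `[< ideal_gen [set quadric_poly q] p >].

Fact quadric_ideal_idealr q : idealr_closed (quadric_ideal q).
Proof.
have [E0 ED EM] := ideal_gen_ideal [set quadric_poly q].
split; first exact/asboolP.
- apply/asboolP.
  suff sub: ideal_gen [set quadric_poly q] `<=` [set p | p@_0%MM = 0].
    by move=> /sub /=; rewrite mcoeff1 eqxx; apply/eqP/oner_neq0.
  apply: ideal_gen_min => [|_ ->].
    split=> [|p r p0 r0|r p p0] /=; first by rewrite mcoeff0.
      by rewrite mcoeffD p0 r0 addr0.
    by rewrite -[_@__]/(mcoeff _ _) rmorphM /= p0 mulr0.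
  by apply: (dhomog_nemf_coeff (quadric_homog q)); rewrite /= mdeg0.
- move=> a p r /asboolP pI /asboolP rI; apply/asboolP.
  by apply: ED => //; exact: EM.
Qed.

HB.instance Definition _ q :=
  isIdealr.Build {mpoly K[m]} (quadric_ideal q) (quadric_ideal_idealr q).

Definition mpoly_grading k : set {mpoly K[m]} := [set p | p \is k.-homog].

Definition quadric_ring (q : quadric) : comAlgType K :=
  alg_quot (quadric_ideal q).

Definition quadric_grading (q : quadric) : nat -> set (quadric_ring q) :=
  quot_grading (quadric_ideal q) mpoly_grading.

End Quadric.
Arguments quadric_grading {K m} q k.

Definition quadric_hypersurface (K : fieldType) (A : comAlgType K)
    (G : nat -> set A) : Prop :=
  exists (m : nat) (q : quadric K m), graded_iso G (quadric_grading q).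

(* Main.v *)
From HB Require Import structures.
Require Import Defs.
From mathcomp Require Import all_boot all_order all_algebra.
From mathcomp Require Import generic_quotient ring_quotient.
From mathcomp Require Import boolp classical_sets.
From mathcomp Require Import freeg mpoly.
From mathcomp Require Import zify ring.

(** Let [F] be the fiber cone of [I], let [r] be its Krull dimension and [h] its
    Hilbert function; then [h 1] and [h 2] are the numbers of generators of [I]
    and [I^2], by graded Nakayama ([num_gen_power]).

    Suppose that the Hilbert series of [F] is c(t) / (1 - t)^r, where c is a
    polynomial with coefficients in the natural numbers and c_0 = 1, such that
    c_i = 0 implies c_(i+1) = 0. Comparing coefficients gives
    h 1 = c_1 + r and h 2 = r h 1 - C(r, 2) + c_2, so [I] is Freiman if and only
    if c_2 = 0. The multiplicity of [F] is the sum of all c_i, so [F] has minimal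
    multiplicity if and only if the sum of the c_i with i >= 2 vanishes, which by
    the assumption on c again means c_2 = 0 ([h_vector_criterion]).

    If [F] is a quadric hypersurface then c(t) = 1 + t. If [F] is
    Cohen-Macaulay, c is the Hilbert function of the quotient of [F] by [r]
    linear forms that form a regular sequence. Two points need care: [K] may be
    finite, and the regular sequence that witnesses the depth need not be
    homogeneous. Both are met by adjoining variables z and using the generic
    linear forms a_0 + a_1 z + a_2 z^2 + ..., where the a_i span [F]_1. Such a
    form is regular as soon as the a_i have no common annihilator
    ([mccoy_regular]), and a given regular sequence can be exchanged, element
    by element, for generic forms ([generic_depth_exchange]). Every generic form
    lowers the Hilbert function to its difference function; ranks are taken over
    the fraction field of K[z_1, ..., z_r] ([generic_depth_hilbert]).

    It remains to see that c is a polynomial, that is, that the Krull dimension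
    is the exponent of growth of [F]. As [I] is generated by monomials of one
    degree [d], [F] is the domain spanned by the monomials [X_w t^k] with [w] a
    sum of [k] exponents of generators ([fiber_poly]). Setting x_1, ..., x_n, t
    equal to 1, one after the other, gives an increasing sequence of kernels,
    which are primes. Let [r] be the number of strict inclusions among them. The
    exponents of the [r] variables that belong to strict inclusions determine a
    monomial of [F], so at most ((d + 1) (k + 1))^r monomials have degree at
    most [k] ([size_filtration]). Conversely, a chain of [e] strict inclusions
    of primes forces growth of order k^e ([prime_chain_independent]). Hence [r]
    is the Krull dimension ([krull_dim_fiber]). *)

Set Implicit Arguments.
Unset Strict Implicit.
Unset Printing Implicit Defensive.

Import GRing.Theory.
Local Open Scope classical_set_scope.
Local Open Scope quotient_scope.
Local Open Scope ring_scope.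

(** * Depth detected by generic linear forms *)

Section GenericDepth.
Implicit Types B : comNzRingType.

Definition regular_mod B (I : set B) f := forall x, I (f * x) -> I x.

Definition ideal_add B (I : set B) f : set B :=
  [set x | exists y z, I y /\ x = y + f * z].

(** For Noetherian [B] this says that the ideal generated by [a] has positive
    grade on [B / I]. *)
Definition socle_free B (a : seq B) (I : set B) :=
  forall x, (forall c, c \in a -> I (c * x)) -> I x.

Definition poly_ideal B (I : set B) : set {poly B} :=
  [set p | forall i, I p`_i].

Lemma idealN B (I : set B) x : is_ideal I -> I x -> I (- x).
Proof. by case=> _ _ IM Ix; rewrite -mulN1r; exact: IM. Qed.

Lemma idealB B (I : set B) x y : is_ideal I -> I x -> I y -> I (x - y).
Proof. by move=> II Ix Iy; case: (II) => _ ID _; apply: ID => //; exact: idealN. Qed.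

Lemma ideal_sum B (I : set B) (T : Type) (r : seq T) (P : pred T) (F : T -> B) :
  is_ideal I -> (forall i, P i -> I (F i)) -> I (\sum_(i <- r | P i) F i).
Proof. by case=> I0 ID _ IF; apply: (big_ind I). Qed.

Lemma ideal_sum_seq B (I : set B) (T : eqType) (r : seq T) (F : T -> B) :
  is_ideal I -> (forall i, i \in r -> I (F i)) -> I (\sum_(i <- r) F i).
Proof. by move=> II IF; rewrite big_seq; exact: ideal_sum. Qed.

Lemma idealMl B (I : set B) x y : is_ideal I -> I y -> I (x * y).
Proof. by case=> _ _; apply. Qed.

Lemma ideal_congr B (I : set B) x y : is_ideal I -> I (x - y) -> I y -> I x.
Proof. by move=> [_ ID _] Ixy Iy; rewrite -(subrK y x); exact: ID. Qed.

Lemma ideal_add_ideal B (I : set B) f : is_ideal I -> is_ideal (ideal_add I f).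
Proof.
move=> II; case: (II) => I0 ID IM; split.
- by exists 0, 0; rewrite mulr0 addr0.
- move=> _ _ [y [z [Iy ->]]] [y' [z' [Iy' ->]]].
  by exists (y + y'), (z + z'); split; [exact: ID | rewrite mulrDr addrACA].
- move=> r _ [y [z [Iy ->]]]; exists (r * y), (r * z).
  by split; [exact: IM | rewrite mulrDr mulrCA].
Qed.

Lemma ideal_add_sub B (I : set B) f x : I x -> ideal_add I f x.
Proof. by move=> Ix; exists x, 0; rewrite mulr0 addr0. Qed.

Lemma ideal_add_mul B (I : set B) f z : is_ideal I -> ideal_add I f (f * z).
Proof. by case=> I0 _ _; exists 0, z; rewrite add0r. Qed.

Lemma ideal_addC B (I : set B) f g :
  ideal_add (ideal_add I f) g = ideal_add (ideal_add I g) f.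
Proof.
have sub h k : ideal_add (ideal_add I h) k `<=` ideal_add (ideal_add I k) h.
  move=> _ [_ [w [[y [z [Iy ->]]] ->]]].
  by exists (y + k * w), z; split; [exists y, w | rewrite addrAC].
by apply/seteqP; split; exact: sub.
Qed.

Lemma poly_ideal_ideal B (I : set B) : is_ideal I -> is_ideal (poly_ideal I).
Proof.
move=> II; case: (II) => I0 ID IM; split.
- by move=> i; rewrite coef0.
- by move=> p q Ip Iq i; rewrite coefD; exact: ID.
- by move=> r p Ip i; rewrite coefM; apply: ideal_sum => // j _; exact: IM.
Qed.

Lemma poly_ideal_add B (I : set B) f : is_ideal I ->
  poly_ideal (ideal_add I f) = ideal_add (poly_ideal I) f%:P.
Proof.
move=> II; apply/seteqP; split=> p; last first.
  by move=> [y [z [Iy ->]]] i; exists y`_i, z`_i; rewrite coefD coefCM.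
move=> Ip.
have /choice [yz yzP] i : exists yz : B * B, I yz.1 /\ p`_i = yz.1 + f * yz.2.
  by have [y [z [Iy e]]] := Ip i; exists (y, z).
exists (\poly_(i < size p) (yz i).1), (\poly_(i < size p) (yz i).2); split.
  by move=> i; rewrite coef_poly; case: ifP => _; [exact: (yzP i).1 | case: II].
apply/polyP => i; rewrite coefD coefCM !coef_poly.
case: ltnP => ip; first exact: (yzP i).2.
by rewrite mulr0 addr0 nth_default.
Qed.

Lemma regular_mod_poly B (I : set B) f :
  regular_mod I f -> regular_mod (poly_ideal I) f%:P.
Proof. by move=> fR p fp i; apply: fR; rewrite -coefCM. Qed.

(** McCoy's argument. If [Poly a] kills [p] modulo [I], then the last entry [e] of
    [a] kills the top coefficient of [p]. Thus [e%:P * p] has smaller degree than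
    [p] modulo [I], so it vanishes by induction, and [e] may be dropped from [a]. *)
Lemma mccoy_regular B (a : seq B) (I : set B) : is_ideal I -> socle_free a I ->
  regular_mod (poly_ideal I) (Poly a).
Proof.
move=> II Ia p; have II' := poly_ideal_ideal II.
have [n] := ubnP (size p); elim: n p => // n IHn p; rewrite ltnS => sp ap.
suff ak c : c \in a -> poly_ideal I (c%:P * p).
  by move=> i; apply: Ia => c ca; rewrite -coefCM; exact: ak.
(* The entries of [a] are shown to kill [p] from the last to the first. *)
suff gen s b : a = s ++ b -> (forall c, c \in b -> poly_ideal I (c%:P * p)) ->
    poly_ideal I (Poly s * p) -> forall c, c \in s -> poly_ideal I (c%:P * p).
  by move: c; apply: (gen a [::]); rewrite ?cats0.
elim/last_ind: s b => [//|s e IHs] b def_a bp sep.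
have lep : I (e * lead_coef p).
  have := sep (size s + (size p).-1)%N.
  have [->|p0] := eqVneq p 0; first by rewrite lead_coef0 !mulr0 coef0.
  rewrite coefM (bigD1 (inord (size s))) //= inordK ?ltnS ?leq_addr //.
  rewrite coef_Poly nth_rcons ltnn eqxx addKn big1 ?addr0 // => i.
  rewrite -val_eqE /= inordK ?ltnS ?leq_addr // => ne_is.
  rewrite coef_Poly; have [lt_si|le_is] := ltnP (size s) i.
    by rewrite (nth_default _ (s := rcons _ _)) ?mul0r // size_rcons.
  rewrite [p`__]nth_default ?mulr0 //.
  have aux u v w : (u != v -> u <= v -> 0 < w -> w <= v + w.-1 - u)%N by lia.
  by apply: aux; rewrite ?size_poly_gt0.
have Itop : poly_ideal I ((e * lead_coef p)%:P * 'X^((size p).-1)).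
  by move=> i; rewrite coefCM coefXn mulrC; apply: idealMl.
have ep : poly_ideal I (e%:P * p).
  pose q := e%:P * p - (e * lead_coef p)%:P * 'X^((size p).-1).
  apply: (ideal_congr II' (y := (e * lead_coef p)%:P * 'X^((size p).-1))) => //.
  have [->|p0] := eqVneq p 0.
    by rewrite lead_coef0 !(mulr0, mul0r) subrr; case: II'.
  rewrite -/q; apply: IHn; last first.
    by rewrite mulrBr mulrCA; refine (idealB II' (idealMl _ II' ap) (idealMl _ II' Itop)).
  apply: leq_trans sp; rewrite -(prednK (n := size p)) ?size_poly_gt0 // ltnS.
  apply/leq_sizeP => j; rewrite leq_eqVlt coefB !coefCM coefXn => /predU1P[<-|jp].
    by rewrite eqxx mulr1 subrr.
  rewrite gtn_eqF // mulr0 subr0 nth_default ?mulr0 //.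
  by rewrite -(prednK (n := size p)) ?size_poly_gt0.
have sp' : poly_ideal I (Poly s * p).
  have -> : Poly s * p = Poly (rcons s e) * p - 'X^(size s) * (e%:P * p).
    rewrite mulrA -mulrBl; congr (_ * p); apply/polyP => i.
    rewrite coefB coefMC coefXn !coef_Poly nth_rcons.
    case: ltngtP => [|ltsi|->]; rewrite ?mul0r ?subr0 // ?mul1r ?subrr nth_default //.
    exact: ltnW.
  by refine (idealB II' sep (idealMl _ II' ep)).
have def_a' : a = s ++ e :: b by rewrite def_a cat_rcons.
have bp' c' : c' \in e :: b -> poly_ideal I (c'%:P * p).
  by rewrite inE => /predU1P[->//|]; exact: bp.
move=> c'; rewrite mem_rcons inE => /predU1P[->//|]; exact: IHs bp' sp' c'.
Qed.

(** If [a] kills [x] modulo [I + g], then [f * x = g * w] modulo [I] for some [w],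
    and [a] kills [w] modulo [I + f]: multiplication by [f / g] identifies the
    socle of [B / (I + g)] with the socle of [B / (I + f)]. *)
Lemma socle_free_exchange B (a : seq B) (I : set B) f g : is_ideal I ->
  ideal_gen [set` a] f -> ideal_gen [set` a] g ->
  regular_mod I f -> regular_mod I g ->
  socle_free a (ideal_add I f) -> socle_free a (ideal_add I g).
Proof.
move=> II af ag fR gR aIf x axg.
have II' h := ideal_add_ideal h II.
have axK h : ideal_gen [set` a] h -> ideal_add I g (h * x).
  move: h; apply: (@ideal_gen_min _ _ [set h | ideal_add I g (h * x)]) => //.
  have [G0 GD GM] := II' g.
  split=> [|h k /= Ih Ik|r h /= Ih]; rewrite /= ?mul0r ?mulrDl -?mulrA //.
    exact: GD.
  exact: GM.
have [y [w [Iy def_fx]]] := axK _ af.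
have : ideal_add I f w.
  apply: aIf => c /axg [yc [wc [Iyc def_cx]]].
  exists (c * w - f * wc), wc; split; last by rewrite subrK.
  apply: gR; have -> : g * (c * w - f * wc) = f * yc - c * y.
    have egw : g * w = f * x - y by rewrite def_fx addrC addKr.
    have egwc : g * wc = c * x - yc by rewrite def_cx addrC addKr.
    by rewrite mulrBr (mulrCA g c) (mulrCA g f) egw egwc; ring.
  by apply: idealB => //; apply: idealMl.
move=> [y' [w' [Iy' def_w]]]; exists (x - g * w'), w'; split; last by rewrite subrK.
apply: fR; rewrite mulrBr def_fx def_w mulrDr (mulrCA f g) addrA addrK.
by case: (II) => _ ID IM; apply: ID => //; exact: IM.
Qed.

(** The half of the permutability of regular sequences that holds in every
    ring. *)
Lemma regular_mod_swap B (I : set B) f g : is_ideal I ->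
  regular_mod I f -> regular_mod (ideal_add I f) g ->
  regular_mod (ideal_add I g) f.
Proof.
move=> II fR gR x [y [w [Iy def_fx]]].
have [|y' [w' [Iy' def_w]]] := gR w.
  exists (- y), x; split; first exact: idealN.
  by rewrite def_fx addKr.
exists (x - g * w'), w'; split; last by rewrite subrK.
apply: fR; rewrite mulrBr def_fx def_w mulrDr (mulrCA f g) addrA addrK.
by case: (II) => _ ID IM; apply: ID => //; exact: IM.
Qed.

(** Depth at least [r], tested on generic linear forms: at each step a variable
    is adjoined to [B] and [Poly a], which is the sum of the [a_i z^i], is divided
    out. By [mccoy_regular] this form is then a regular element. *)
Fixpoint generic_depth r B (a : seq B) (I : set B) : Prop :=
  if r is r'.+1 then socle_free a I /\
    @generic_depth r' {poly B} (map polyC a) (ideal_add (poly_ideal I) (Poly a))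
  else True.

Lemma ideal_gen_polyC B (a : seq B) f :
  ideal_gen [set` a] f -> ideal_gen [set` map polyC a] f%:P.
Proof.
move=> [s sa ->]; exists [seq (u.1%:P, u.2%:P) | u <- s].
  by move=> u /mapP[v /sa va ->]; apply/mapP; exists v.2.
by rewrite big_map rmorph_sum; apply: eq_bigr => u _; rewrite rmorphM.
Qed.

Lemma ideal_gen_Poly B (a : seq B) : ideal_gen [set` map polyC a] (Poly a).
Proof.
rewrite -[Poly a]coefK poly_def.
apply: ideal_sum_seq; first exact: ideal_gen_ideal.
move=> i _; rewrite -mul_polyC mulrC; apply: idealMl; first exact: ideal_gen_ideal.
rewrite coef_Poly; apply/ideal_gen_sub/mapP; exists a`_i => //.
by apply: mem_nth; apply: leq_trans (size_Poly a).
Qed.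

(** The depth of [B / (I + f)] is the same for all regular [f] in the ideal
    generated by [a]. For [f] and [g] the first generic form is regular on both
    quotients, by [socle_free_exchange]. Moved in front of [f] and [g], it reduces
    the claim to [f] and [g] modulo that form, where one step less remains. *)
Lemma generic_depth_exchange r B (a : seq B) (I : set B) f g : is_ideal I ->
  ideal_gen [set` a] f -> ideal_gen [set` a] g ->
  regular_mod I f -> regular_mod I g ->
  generic_depth r a (ideal_add I f) -> generic_depth r a (ideal_add I g).
Proof.
elim: r B a I f g => [//|r IHr] B a I f g II af ag fR gR [aIf dIf].
have aIg := socle_free_exchange II af ag fR gR aIf.
split=> //; move: dIf; have II' := poly_ideal_ideal II.
rewrite !poly_ideal_add // [ideal_add (ideal_add _ f%:P) _]ideal_addC.
rewrite [ideal_add (ideal_add _ g%:P) _]ideal_addC.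
have swap h : regular_mod I h -> socle_free a (ideal_add I h) ->
    regular_mod (ideal_add (poly_ideal I) (Poly a)) h%:P.
  move=> hR aIh; apply: regular_mod_swap => //; first exact: regular_mod_poly.
  by rewrite -poly_ideal_add //; apply: mccoy_regular => //; exact: ideal_add_ideal.
apply: IHr; [exact: ideal_add_ideal | exact: ideal_gen_polyC ..
            | exact: swap | exact: swap].
Qed.

Fixpoint regular_seq_mod B (xs : seq B) (I : set B) : Prop :=
  if xs is f :: xs' then regular_mod I f /\ regular_seq_mod xs' (ideal_add I f)
  else True.

Lemma regular_seq_mod_poly B (xs : seq B) (I : set B) : is_ideal I ->
  regular_seq_mod xs I -> regular_seq_mod (map polyC xs) (poly_ideal I).
Proof.
elim: xs I => //= f xs IHxs I II [fR xsR]; split; first exact: regular_mod_poly.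
by rewrite -poly_ideal_add //; apply: IHxs => //; exact: ideal_add_ideal.
Qed.

(** In [B[z]] the first element [f] of the sequence and the generic form are both
    regular modulo [I]; the induction applies to the rest of the sequence modulo
    [f], and [f] is then exchanged for the generic form. *)
Lemma generic_depth_regular B (a xs : seq B) (I : set B) : is_ideal I ->
  {in xs, forall f, ideal_gen [set` a] f} ->
  regular_seq_mod xs I -> generic_depth (size xs) a I.
Proof.
have [r] := ubnP (size xs); elim: r B a xs I => // r IHr B a [//|f xs] I.
rewrite /= ltnS => lt_r II.
move=> xsa [fR xsR] /=; have af : ideal_gen [set` a] f by apply/xsa/mem_head.
have aI : socle_free a I.
  move=> x ax; apply: fR; move: {xsR xsa} (f) af.
  apply: (@ideal_gen_min _ _ [set f | I (f * x)]) => //.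
  case: (II) => I0 ID IM; split=> [|h k /= Ih Ik|s h /= Ih]; rewrite /= ?mul0r //.
    by rewrite mulrDl; exact: ID.
  by rewrite -mulrA; exact: IM.
split=> //; have II' := poly_ideal_ideal II.
apply: (@generic_depth_exchange _ _ _ _ f%:P) => //.
- exact: ideal_gen_polyC.
- exact: ideal_gen_Poly.
- exact: regular_mod_poly.
- exact: mccoy_regular.
rewrite -poly_ideal_add // -(size_map polyC); apply: IHr.
- by rewrite size_map.
- exact/poly_ideal_ideal/ideal_add_ideal.
- move=> _ /mapP[g gxs ->]; apply/ideal_gen_polyC/xsa.
  by rewrite inE gxs orbT.
by apply: regular_seq_mod_poly => //; exact: ideal_add_ideal.
Qed.

Lemma ideal_gen_rcons B (s : seq B) f :
  ideal_gen [set` rcons s f] = ideal_add (ideal_gen [set` s]) f.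
Proof.
have Is := ideal_gen_ideal [set` s]; have Ir := ideal_gen_ideal [set` rcons s f].
apply/seteqP; split.
  apply: ideal_gen_min => [|g /=]; first exact: ideal_add_ideal.
  rewrite mem_rcons inE => /predU1P[->|gs]; last exact/ideal_add_sub/ideal_gen_sub.
  by rewrite -[X in ideal_add _ _ X]mulr1; exact: ideal_add_mul.
move=> _ [y [z [ys ->]]]; case: (Ir) => _ ID _; apply: ID.
  move: y ys; apply: ideal_gen_min => // y ys; apply: ideal_gen_sub.
  by rewrite /= mem_rcons inE ys orbT.
by rewrite mulrC; apply: idealMl => //; apply: ideal_gen_sub; rewrite /= mem_rcons mem_head.
Qed.

Lemma generic_depth_regular_sequence B (a xs : seq B) :
  {in xs, forall f, ideal_gen [set` a] f} -> regular_sequence xs ->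
  generic_depth (size xs) a (ideal_gen [set` [::]]).
Proof.
move=> xsa [xsR _]; apply: generic_depth_regular => //.
  exact: ideal_gen_ideal.
suff gen (s t : seq B) : (forall i, (i < size t)%N ->
    regular_mod (ideal_gen [set` s ++ take i t]) t`_i) ->
    regular_seq_mod t (ideal_gen [set` s]).
  by apply: gen => i ix x; exact: xsR.
elim: t s => //= f t IHt s sR; split.
  by have := sR 0%N isT; rewrite /= cats0.
by rewrite -ideal_gen_rcons; apply: IHt => i it; rewrite cat_rcons; exact: (sR i.+1).
Qed.

End GenericDepth.

(** * Rank over the fraction field of a domain *)

Lemma common_denominator (Z : idomainType) (T : finType) (f : T -> {fraction Z}) :
  exists s : Z, s != 0 /\ exists g : T -> Z, forall i, tofrac s * f i = tofrac (g i).
Proof.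
have frac1 (x : {fraction Z}) : exists nd : Z * Z,
    nd.2 != 0 /\ tofrac nd.2 * x = tofrac nd.1.
  elim/quotW: x => x; exists (\n_x, \d_x); split; first exact: denom_ratioP.
  rewrite /= mulrC; unlock tofrac; rewrite -[LHS]FracField.pi_mul.
  apply/eqmodP; rewrite /= FracField.equivfE /FracField.mulf.
  by rewrite !numden_Ratio ?mulf_neq0 ?oner_eq0 ?denom_ratioP // !mulr1 mulrC.
have /choice [nd ndP] i := frac1 (f i).
exists (\prod_i (nd i).2); split; first by apply/prodf_neq0 => i _; case: (ndP i).
exists (fun i => \prod_(j | j != i) (nd j).2 * (nd i).1) => i.
by rewrite (bigD1 i) //= mulrC !rmorphM /= -(ndP i).2; ring.
Qed.

Lemma exists_left_kernel (Z : idomainType) p q (C : 'M[Z]_(p, q)) : (q < p)%N ->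
  exists2 e : 'rV_p, e != 0 & e *m C = 0.
Proof.
move=> lt_qp; pose CF := map_mx (@tofrac Z) C.
have: kermx CF != 0.
  rewrite kermx_eq0 /row_free neq_ltn; apply/orP; left.
  exact: leq_ltn_trans (rank_leq_col _) lt_qp.
case/rowV0Pn => v /sub_kermxP vC v0.
have [s [s0 [g gP]]] := common_denominator (v ord0).
have gv : map_mx (@tofrac Z) (\row_j g j) = tofrac s *: v.
  by apply/rowP => j; rewrite !mxE -gP.
have s0' : tofrac s != 0 by rewrite tofrac_eq0.
exists (\row_j g j).
  apply: contraNneq v0 => g0; move: gv; rewrite g0 map_mx0 => /esym/eqP.
  by rewrite scaler_eq0 (negPf s0').
apply/rowP => j; rewrite !mxE; apply/eqP; rewrite -tofrac_eq0 rmorph_sum; apply/eqP.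
transitivity ((map_mx (@tofrac Z) (\row_j g j) *m CF) ord0 j).
  by rewrite !mxE; apply: eq_bigr => k _; rewrite !mxE rmorphM.
by rewrite gv -scalemxAl vC scaler0 mxE.
Qed.

Section Rank.
Variables (Z : idomainType) (B : comNzRingType) (sigma : {rmorphism Z -> B}).
Variable I : set B.
Hypothesis II : is_ideal I.

Definition lincomb (c : nat -> Z) (b : seq B) : B :=
  \sum_(i < size b) sigma (c i) * b`_i.

(** Coefficients are allowed a denominator: this is dependence over the
    fraction field of [Z]. *)
Definition depends (b : seq B) x :=
  exists2 s, s != 0 & exists c, I (sigma s * x - lincomb c b).

Definition independent (b : seq B) :=
  forall c, I (lincomb c b) -> forall i, (i < size b)%N -> c i = 0.

Lemma lincomb_ind (P : B -> Prop) c b : P 0 -> (forall x y, P x -> P y -> P (x + y)) ->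
  (forall t x, x \in b -> P (sigma t * x)) -> P (lincomb c b).
Proof. by move=> P0 PD PZ; apply: (big_ind P) => // i _; apply/PZ/mem_nth. Qed.

Lemma lincombD c c' b : lincomb (fun i => c i + c' i) b = lincomb c b + lincomb c' b.
Proof. by rewrite -big_split; apply: eq_bigr => i _; rewrite rmorphD mulrDl. Qed.

Lemma lincombZ t c b : lincomb (fun i => t * c i) b = sigma t * lincomb c b.
Proof. by rewrite mulr_sumr; apply: eq_bigr => i _; rewrite rmorphM mulrA. Qed.

Lemma lincombB c c' b : lincomb (fun i => c i - c' i) b = lincomb c b - lincomb c' b.
Proof. by rewrite -sumrB; apply: eq_bigr => i _; rewrite rmorphB mulrBl. Qed.

Lemma lincomb0 b : lincomb (fun=> 0) b = 0.
Proof. by rewrite /lincomb big1 // => i _; rewrite rmorph0 mul0r. Qed.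

Lemma lincomb_delta b i : (i < size b)%N -> lincomb (fun j => (j == i)%:R) b = b`_i.
Proof.
move=> ib; rewrite /lincomb (bigD1 (Ordinal ib)) //= eqxx rmorph1 mul1r.
rewrite big1 ?addr0 // => j; rewrite -val_eqE /= => /negPf ->.
by rewrite rmorph0 mul0r.
Qed.

Lemma lincomb_cons c x b :
  lincomb c (x :: b) = sigma (c 0%N) * x + lincomb (fun i => c i.+1) b.
Proof. by rewrite /lincomb /= big_ord_recl. Qed.

Lemma lincomb_cat c b b' :
  lincomb c (b ++ b') = lincomb c b + lincomb (fun i => c (size b + i)%N) b'.
Proof.
elim: b c => [|x b IHb] c /=; first by rewrite [X in _ = X + _]/lincomb big_ord0 add0r.
by rewrite !lincomb_cons IHb addrA.
Qed.

Lemma lincomb_mul c g b : lincomb c (map ( *%R g) b) = g * lincomb c b.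
Proof.
rewrite /lincomb size_map mulr_sumr; apply: eq_bigr => i _.
by rewrite (nth_map 0) // mulrCA.
Qed.

Lemma depends_ideal b x : I x -> depends b x.
Proof.
move=> Ix; exists 1; first exact: oner_neq0.
by exists (fun=> 0); rewrite lincomb0 subr0 rmorph1 mul1r.
Qed.

Lemma depends_mem b x : x \in b -> depends b x.
Proof.
move=> xb; exists 1; first exact: oner_neq0.
exists (fun j => (j == index x b)%:R).
rewrite lincomb_delta ?index_mem // nth_index // rmorph1 mul1r subrr.
by case: II.
Qed.

Lemma dependsD b x y : depends b x -> depends b y -> depends b (x + y).
Proof.
move=> [s s0 [c Ix]] [t t0 [d Iy]]; exists (s * t); first exact: mulf_neq0.
exists (fun i => t * c i + s * d i); rewrite lincombD !lincombZ.
have -> : sigma (s * t) * (x + y) - (sigma t * lincomb c b + sigma s * lincomb d b) =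
    sigma t * (sigma s * x - lincomb c b) + sigma s * (sigma t * y - lincomb d b).
  by rewrite rmorphM; ring.
by case: (II) => _ ID IM; apply: ID; exact: IM.
Qed.

Lemma dependsZ b t x : depends b x -> depends b (sigma t * x).
Proof.
move=> [s s0 [c Ix]]; exists s => //; exists (fun i => t * c i); rewrite lincombZ.
by rewrite mulrCA -mulrBr; exact: idealMl.
Qed.

Lemma depends_div b t x : t != 0 -> depends b (sigma t * x) -> depends b x.
Proof.
move=> t0 [s s0 [c Ix]]; exists (s * t); first exact: mulf_neq0.
by exists c; rewrite rmorphM -mulrA.
Qed.

Lemma depends_lincomb b c b' :
  (forall x, x \in b' -> depends b x) -> depends b (lincomb c b').
Proof.
move=> b'b; apply: lincomb_ind => [||t x /b'b]; last exact: dependsZ.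
  by apply: depends_ideal; case: II.
by move=> x y; exact: dependsD.
Qed.

Lemma depends_trans b b' x :
  (forall y, y \in b' -> depends b y) -> depends b' x -> depends b x.
Proof.
move=> b'b [s s0 [c Ix]]; apply: (depends_div s0).
rewrite -(subrK (lincomb c b') (_ * x)); apply: dependsD.
  exact: depends_ideal.
exact: depends_lincomb.
Qed.

(** Over a domain, a matrix with more rows than columns has a linear relation
    between its rows. *)
Lemma independent_size b b' :
  independent b -> (forall x, x \in b -> depends b' x) -> (size b <= size b')%N.
Proof.
move=> bI bb'; rewrite leqNgt; apply/negP => lt_b.
have /choice [sc scP] (i : 'I_(size b)) : exists sc : Z * (nat -> Z),
    sc.1 != 0 /\ I (sigma sc.1 * b`_i - lincomb sc.2 b').
  by have [|s s0 [c cP]] := bb' b`_i; [exact: mem_nth | exists (s, c)].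
have [e e0 eC] := exists_left_kernel (\matrix_(i < size b, j < size b') (sc i).2 j) lt_b.
case/eqP: e0; apply/rowP => i; rewrite mxE.
pose c j := if insub j is Some i then e ord0 i * (sc i).1 else 0.
have cE (j : 'I_(size b)) : c j = e ord0 j * (sc j).1 by rewrite /c valK.
have/bI : I (lincomb c b).
  have -> : lincomb c b = \sum_(i < size b)
      sigma (e ord0 i) * (sigma (sc i).1 * b`_i - lincomb (sc i).2 b').
    have -> : lincomb c b = \sum_(i < size b) sigma (e ord0 i) * (sigma (sc i).1 * b`_i).
      by apply: eq_bigr => j _; rewrite cE rmorphM mulrA.
    apply/eqP; rewrite -subr_eq0 -sumrB; apply/eqP.
    under eq_bigr do rewrite -mulrBr opprB addrCA subrr addr0 mulr_sumr.
    rewrite exchange_big big1 // => j _; transitivity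
       (sigma ((e *m (\matrix_(i < size b, j < size b') (sc i).2 j)) ord0 j) * b'`_j).
      rewrite mxE rmorph_sum mulr_suml; apply: eq_bigr => k _.
      by rewrite !mxE rmorphM mulrA.
    by rewrite eC mxE rmorph0 mul0r.
  by apply: ideal_sum => // j _; apply: idealMl => //; case: (scP j).
move/(_ i (ltn_ord i)); rewrite cE => /eqP; rewrite mulf_eq0.
by case: (scP i) => /negPf -> _; rewrite orbF => /eqP.
Qed.

(** The rank of the image of [V] in [B / I] over the fraction field of [Z]. *)
Definition has_rank (V : set B) h := exists b,
  [/\ size b = h, forall x, x \in b -> V x, independent b & forall x, V x -> depends b x].

Lemma has_rank_uniq V h h' : has_rank V h -> has_rank V h' -> h = h'.
Proof.
move=> [b [<- bV bI bD]] [b' [<- b'V b'I b'D]]; apply/eqP; rewrite eqn_leq.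
by rewrite !independent_size //; [move=> x /b'V/bD | move=> x /bV/b'D].
Qed.

Lemma exists_rank V w : (forall x, x \in w -> V x) -> (forall x, V x -> depends w x) ->
  exists h, has_rank V h.
Proof.
move=> wV Vw.
suff [b [bw bI wb]] : exists b, [/\ {subset b <= w}, independent b &
    forall x, x \in w -> depends b x].
  exists (size b), b; split=> // x; first by move/bw/wV.
  by move/Vw; exact: depends_trans.
elim: w {wV Vw} => [|x w [b [bw bI wb]]]; first by exists [::]; split=> // c _ [].
have [xb|xNb] := pselect (depends b x).
  exists b; split=> // y; first by move/bw; rewrite inE orbC => ->.
  by rewrite inE => /predU1P[->|/wb].
exists (x :: b); split=> [y||y].
- by rewrite !inE => /orP[->//|/bw ->]; rewrite orbT.
- move=> c; rewrite lincomb_cons => Ic.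
  have c0 : c 0%N = 0.
    apply/eqP/negPn/negP => c0; apply: xNb; exists (c 0%N) => //.
    exists (fun i => - c i.+1); suff -> : lincomb (fun i => - c i.+1) b =
      - lincomb (fun i => c i.+1) b by rewrite opprK.
    by rewrite -[RHS]sub0r -(lincomb0 b) -lincombB; apply: eq_bigr => i _; rewrite sub0r.
  move: Ic; rewrite c0 rmorph0 mul0r add0r => /bI cI [|i] //; exact: cI.
- have sub z : z \in b -> depends (x :: b) z.
    by move=> zb; apply: depends_mem; rewrite inE zb orbT.
  rewrite inE => /predU1P[->|/wb]; first by apply: depends_mem; rewrite mem_head.
  exact: depends_trans.
Qed.

End Rank.

(** * Hilbert functions modulo generic linear forms *)

(** If [c] has generating series c(t), then [psum r c] has generating series
    c(t) / (1 - t)^r. *)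
Fixpoint psum r (c : nat -> nat) k : nat :=
  if r is r'.+1 then (\sum_(i < k.+1) psum r' c i)%N else c k.

Lemma depends_subset (Z : idomainType) (B : comNzRingType) (sigma : {rmorphism Z -> B})
    (I J : set B) b x :
  I `<=` J -> depends sigma I b x -> depends sigma J b x.
Proof. by move=> IJ [s s0 [c Ix]]; exists s => //; exists c; exact: IJ. Qed.

Section Graded.
Variables (Z : idomainType) (B : comNzRingType) (sigma : {rmorphism Z -> B}).
Variable pi : nat -> B -> B.

(** A grading is encoded by the projections to its components; [pi k x] is the
    component of degree [k] of [x]. This form extends coefficientwise to
    polynomials. *)
Record grading_projections : Prop := GradingProjections {
  gr_add : forall k, {morph pi k : x y / x + y};
  gr_sigma : forall k s x, pi k (sigma s * x) = sigma s * pi k x;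
  gr_idem : forall k x, pi k (pi k x) = pi k x }.

Record standard_graded (a : seq B) : Prop := StandardGraded {
  gr_proj : grading_projections;
  gr_mul : forall k c x, c \in a -> pi k.+1 (c * x) = c * pi k x;
  gr_mul0 : forall c x, c \in a -> pi 0 (c * x) = 0;
  gr_span : forall k x, exists y : nat -> B,
    pi k.+1 x = \sum_(i < size a) a`_i * pi k (y i) }.

Definition component k : set B := [set x | pi k x = x].

Definition homogeneous_ideal (I : set B) := forall x k, I x -> I (pi k x).

Definition homogeneous_mul s g :=
  (forall k x, pi (k + s)%N (g * x) = g * pi k x) /\
  (forall k x, (k < s)%N -> pi k (g * x) = 0).

Hypothesis G : grading_projections.

Lemma gr_0 k : pi k 0 = 0.
Proof. by apply: (addrI (pi k 0)); rewrite -(gr_add G) !addr0. Qed.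

Lemma gr_sum k (T : Type) (r : seq T) (P : pred T) (F : T -> B) :
  pi k (\sum_(i <- r | P i) F i) = \sum_(i <- r | P i) pi k (F i).
Proof. exact: (big_morph _ (gr_add G k) (gr_0 k)). Qed.

Lemma gr_opp k x : pi k (- x) = - pi k x.
Proof. by apply: (addrI (pi k x)); rewrite -(gr_add G) !subrr gr_0. Qed.

Lemma component_lincomb k c b : (forall x, x \in b -> component k x) ->
  component k (lincomb sigma c b).
Proof.
move=> bV; apply: lincomb_ind => [||t x /bV xV]; rewrite /component /= ?gr_0 //.
  by move=> x y; rewrite (gr_add G) => -> ->.
by rewrite (gr_sigma G) xV.
Qed.

Lemma homogeneous_ideal_add I s g : homogeneous_ideal I -> homogeneous_mul s g ->
  homogeneous_ideal (ideal_add I g).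
Proof.
move=> IH [gH gH0] _ k [y [z [Iy ->]]]; rewrite (gr_add G).
have [lt_ks|le_sk] := ltnP k s.
  by rewrite gH0 // addr0; apply/ideal_add_sub/IH.
by rewrite -(subnK le_sk) gH; exists (pi (k - s + s)%N y), (pi (k - s)%N z); split=> //;
  exact: IH.
Qed.

Section Exact.
Variables (I : set B) (s : nat) (g : B).
Hypotheses (II : is_ideal I) (IH : homogeneous_ideal I).
Hypotheses (gH : homogeneous_mul s g) (gR : regular_mod I g).

(** Additivity of the rank along
    0 -> (B / I)_k -> (B / I)_(k + s) -> (B / (I + g))_(k + s) -> 0,
    whose first map is multiplication by [g]. *)
Lemma has_rank_exact k h1 h2 : has_rank sigma I (component k) h1 ->
  has_rank sigma (ideal_add I g) (component (k + s)) h2 ->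
  has_rank sigma I (component (k + s)) (h1 + h2).
Proof.
move=> [b1 [<- b1V b1I b1D]] [b2 [<- b2V b2I b2D]].
exists (map ( *%R g) b1 ++ b2); split.
- by rewrite size_cat size_map.
- move=> x; rewrite mem_cat => /orP[/mapP[y /b1V yV ->]|/b2V //].
  by rewrite /component /= (gH.1) yV.
- move=> c; rewrite lincomb_cat lincomb_mul size_map => Ic i.
  rewrite size_cat size_map.
  have c2 j : (j < size b2)%N -> c (size b1 + j)%N = 0.
    move=> jb; apply: (b2I (fun i => c (size b1 + i)%N)) => //.
    by exists (g * lincomb sigma c b1 + lincomb sigma (fun i => c (size b1 + i)%N) b2),
      (- lincomb sigma c b1); split=> //; rewrite mulrN addrAC subrr add0r.
  have [lt_i _|le_i lt_i] := ltnP i (size b1); last first.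
    by rewrite -(subnKC le_i); apply: c2; rewrite ltn_subLR.
  apply: b1I => //; apply: gR.
  have e : lincomb sigma (fun i => c (size b1 + i)%N) b2 = 0.
    by rewrite /lincomb big1 // => j _; rewrite c2 // rmorph0 mul0r.
  by rewrite e addr0 in Ic.
move=> x xV; have [t t0 [c [y [z [Iy def_x]]]]] := b2D x xV.
set b := _ ++ b2; apply: (depends_div t0).
have -> : sigma t * x = lincomb sigma c b2 + (pi (k + s)%N y + g * pi k z).
  rewrite -gH.1 -(gr_add G) -def_x (gr_add G) gr_opp (gr_sigma G) xV.
  by rewrite [pi _ (lincomb _ _ _)]component_lincomb // addrC subrK.
apply: dependsD => //.
  apply: depends_lincomb => // w wb; apply: depends_mem => //.
  by rewrite mem_cat wb orbT.
apply: dependsD => //; first exact/depends_ideal/IH.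
have [s' s0 [d Id]] := b1D (pi k z) (gr_idem G k z).
exists s' => //; exists (fun i => if (i < size b1)%N then d i else 0).
rewrite lincomb_cat lincomb_mul size_map mulrCA.
have -> : lincomb sigma
    (fun i => if (size b1 + i < size b1)%N then d (size b1 + i)%N else 0) b2 = 0.
  by rewrite /lincomb big1 // => j _; rewrite ltnNge leq_addr rmorph0 mul0r.
have -> : lincomb sigma (fun i => if (i < size b1)%N then d i else 0) b1 = lincomb sigma d b1.
  by apply: eq_bigr => j _; rewrite ltn_ord.
by rewrite addr0 -mulrBr; exact: idealMl.
Qed.

Lemma exists_rank_add j h : has_rank sigma I (component j) h ->
  exists h', has_rank sigma (ideal_add I g) (component j) h'.
Proof.
move=> [b [_ bV _ bD]]; apply: (@exists_rank _ _ _ _ _ _ b) => //.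
  exact: ideal_add_ideal.
by move=> x /bD; apply: depends_subset => y; exact: ideal_add_sub.
Qed.

Lemma has_rank_low j h : (j < s)%N -> has_rank sigma I (component j) h ->
  has_rank sigma (ideal_add I g) (component j) h.
Proof.
move=> lt_js [b [sb bV bI bD]]; exists b; split=> //.
  move=> c [y [z [Iy e]]]; apply: bI.
  rewrite -(component_lincomb c bV) e (gr_add G) gH.2 // addr0; exact: IH.
by move=> x /bD; apply: depends_subset => y; exact: ideal_add_sub.
Qed.

End Exact.
End Graded.

Section PolyGraded.
Variables (Z : idomainType) (B : comNzRingType) (sigma : {rmorphism Z -> B}).
Variables (pi : nat -> B -> B) (a : seq B).

Definition poly_sigma : {rmorphism {poly Z} -> {poly B}} := map_poly sigma.

Definition poly_proj k (p : {poly B}) : {poly B} := map_poly (pi k) p.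

Hypothesis G : standard_graded sigma pi a.
Let G0 : grading_projections sigma pi := gr_proj G.

Lemma coef_poly_proj k p i : (poly_proj k p)`_i = pi k p`_i.
Proof. by rewrite coef_map_id0 // (gr_0 G0). Qed.

Lemma coef_poly_sigma (c : {poly Z}) i : (poly_sigma c)`_i = sigma c`_i.
Proof. exact: coef_map. Qed.

Lemma poly_grading_projections : grading_projections poly_sigma poly_proj.
Proof.
split=> [k p q|k s p|k p]; apply/polyP => i.
- by rewrite !(coefD, coef_poly_proj) (gr_add G0).
- rewrite coef_poly_proj !coefM (gr_sum G0); apply: eq_bigr => j _.
  by rewrite coef_poly_sigma coef_poly_proj (gr_sigma G0).
- by rewrite !coef_poly_proj (gr_idem G0).
Qed.

Lemma poly_standard_graded : standard_graded poly_sigma poly_proj (map polyC a).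
Proof.
split; first exact: poly_grading_projections.
- move=> k _ p /mapP[c ca ->]; apply/polyP => i.
  by rewrite coef_poly_proj !coefCM coef_poly_proj (gr_mul G).
- move=> _ p /mapP[c ca ->]; apply/polyP => i.
  by rewrite coef_poly_proj !coefCM coef0 (gr_mul0 G).
- move=> k p.
  have /choice [y yP] i := gr_span G k p`_i.
  exists (fun j => \poly_(i < size p) y i j); apply/polyP => i.
  rewrite coef_poly_proj coef_sum size_map.
  have [lt_i|le_i] := ltnP i (size p); last first.
    rewrite nth_default // (gr_0 G0) big1 // => j _.
    rewrite (nth_map 0) // coefCM coef_poly_proj coef_poly ltnNge le_i /=.
    by rewrite (gr_0 G0) mulr0.
  rewrite yP; apply: eq_bigr => j _.
  by rewrite (nth_map 0) // coefCM coef_poly_proj coef_poly lt_i.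
Qed.

Lemma homogeneous_mul_Poly : homogeneous_mul poly_proj 1 (Poly a).
Proof.
have aP i : a`_i \in a \/ a`_i = 0.
  by case: (ltnP i (size a)) => ia; [left; exact: mem_nth | right; rewrite nth_default].
split=> [k p|[|k] p lt_k1]; [| |by []]; apply/polyP => i;
  rewrite coef_poly_proj coefM (gr_sum G0).
  rewrite addn1 coefM; apply: eq_bigr => j _; rewrite coef_poly_proj coef_Poly.
  by case: (aP j) => [/(gr_mul G) -> //|->]; rewrite !mul0r (gr_0 G0).
rewrite coef0 big1 // => j _; rewrite coef_Poly.
by case: (aP j) => [/(gr_mul0 G) -> //|->]; rewrite !mul0r (gr_0 G0).
Qed.

Lemma homogeneous_poly_ideal I : homogeneous_ideal pi I ->
  homogeneous_ideal poly_proj (poly_ideal I).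
Proof. by move=> IH p k Ip i; rewrite coef_poly_proj; exact: IH. Qed.

Lemma coef_lincomb_poly (c : nat -> {poly Z}) b j :
  (lincomb poly_sigma c (map polyC b))`_j = lincomb sigma (fun i => (c i)`_j) b.
Proof.
rewrite /lincomb coef_sum size_map; apply: eq_bigr => i _.
by rewrite (nth_map 0) // coefMC coef_poly_sigma.
Qed.

Lemma depends_polyC I b x : is_ideal I -> depends sigma I b x ->
  depends poly_sigma (poly_ideal I) (map polyC b) x%:P.
Proof.
move=> II [s s0 [c Ix]]; exists s%:P; first by rewrite polyC_eq0.
exists (fun i => (c i)%:P) => j.
have -> : poly_sigma s%:P * x%:P = (sigma s * x)%:P.
  by rewrite /poly_sigma /= map_polyC rmorphM.
rewrite coefB coefC coef_lincomb_poly; case: j => [|j].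
  have -> : lincomb sigma (fun i => ((c i)%:P)`_0) b = lincomb sigma c b.
    by apply: eq_bigr => i _; rewrite coefC.
  by [].
rewrite /lincomb big1 ?subrr => [|i _]; last by rewrite coefC rmorph0 mul0r.
by case: II.
Qed.

(** Flat base change: the constants [b] remain a basis after a variable is
    adjoined to both the ring and its coefficients. *)
Lemma has_rank_poly I k h : is_ideal I -> has_rank sigma I (component pi k) h ->
  has_rank poly_sigma (poly_ideal I) (component poly_proj k) h.
Proof.
move=> II [b [<- bV bI bD]]; exists (map polyC b); split; first exact: size_map.
- move=> _ /mapP[x /bV xV ->]; apply/polyP => i.
  by rewrite coef_poly_proj !coefC; case: ifP => _; rewrite ?(gr_0 G0).
- move=> c Ic i; rewrite size_map => ib; apply/polyP => j; rewrite coef0.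
  by apply: (bI (fun i => (c i)`_j)) => //; rewrite -coef_lincomb_poly.
move=> p pV; rewrite -[p]coefK poly_def.
apply: (big_ind (depends poly_sigma (poly_ideal I) (map polyC b))) => [||i _].
- by apply: depends_ideal => //; case: (poly_ideal_ideal II).
- by move=> x y; apply: dependsD; exact: poly_ideal_ideal.
rewrite -mul_polyC mulrC.
have -> : 'X^i = poly_sigma 'X^i by rewrite /poly_sigma /= map_polyXn.
apply: dependsZ; first exact: poly_ideal_ideal.
by apply: depends_polyC => //; apply: bD; rewrite /component /= -coef_poly_proj pV.
Qed.

End PolyGraded.

(** A generic linear form on [B / I] lowers the Hilbert function to its
    difference function. Once the depth is used up, what remains vanishes in
    degree [k.+1] as soon as it vanishes in degree [k], because it is generated
    in degree 1. *)
Theorem generic_depth_hilbert r (Z : idomainType) (B : comNzRingType)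
    (sigma : {rmorphism Z -> B}) pi (a : seq B) (I : set B) h :
  standard_graded sigma pi a -> is_ideal I -> homogeneous_ideal pi I ->
  (forall k, has_rank sigma I (component pi k) (h k)) -> generic_depth r a I ->
  exists c, (forall k, h k = psum r c k) /\ (forall k, c k = 0%N -> c k.+1 = 0%N).
Proof.
elim: r Z B sigma pi a I h => [|r IHr] Z B sigma pi a I h G II IH hP.
  move=> _; exists h; split=> // k hk0.
  have [b [sb _ _ bD]] := hP k; move: sb; rewrite hk0 => /size0nil b0.
  have [b' [<- b'V b'I _]] := hP k.+1.
  apply/eqP; rewrite -leqn0 -[0%N]/(size (Nil B)).
  apply: (independent_size II b'I) => x /b'V <-.
  have [y ->] := gr_span G k x; apply: (big_ind (depends sigma I [::])) => [||i _].
  - by apply: depends_ideal => //; case: II.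
  - by move=> u v; exact: dependsD.
  have [|s s0 [c]] := bD (pi k (y i)); first exact: (gr_idem (gr_proj G)).
  rewrite b0 /lincomb big_ord0 subr0 => Is; exists s => //; exists (fun=> 0).
  by rewrite /lincomb big_ord0 subr0 mulrCA; exact: idealMl.
move=> [aI dI]; have G' := poly_standard_graded G; have II' := poly_ideal_ideal II.
have P' := gr_proj G'; have IH' := homogeneous_poly_ideal G IH.
have gH := homogeneous_mul_Poly G; have gR := mccoy_regular II aI.
have hP' k := has_rank_poly G II (hP k).
have /choice [h' h'P] k := exists_rank_add (Poly a) II' (hP' k).
have [||c [h'c cP]] := IHr _ _ _ _ _ _ h' G' _ _ h'P dI.
- exact: ideal_add_ideal.
- exact: (homogeneous_ideal_add P' IH' gH).
exists c; split=> //= k; elim: k => [|k IHk].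
  rewrite big_ord1 -h'c; apply: (has_rank_uniq II' (hP' 0%N)).
  have h0 := has_rank_low P' IH' gH (ltn0Sn 0) (hP' 0%N).
  by rewrite -(has_rank_uniq (ideal_add_ideal (Poly a) II') h0 (h'P 0%N)).
rewrite big_ord_recr /= -IHk -h'c.
apply: (has_rank_uniq II' (hP' k.+1)); rewrite -addn1.
by apply: (has_rank_exact P' II' IH' gH gR) => //; rewrite addn1.
Qed.

(** * Iterated partial sums and the multiplicity *)

Lemma leq_bin_expn m r : ('C(m + r, r) <= m.+1 ^ r)%N.
Proof.
elim: r => [|r IHr]; first by rewrite bin0.
rewrite -(leq_pmul2l (ltn0Sn r)) addnS -mul_bin_diag expnS.
apply: leq_trans (_ : (m + r).+1 * m.+1 ^ r <= _)%N; first by rewrite leq_mul.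
by rewrite mulnA leq_mul //; lia.
Qed.

Lemma fact_bin_step m r :
  (r.+1`! * 'C(m + r.+1, r.+1) = (m + r).+1 * (r`! * 'C(m + r, r)))%N.
Proof. by rewrite factS addnS [in RHS]mulnCA mul_bin_diag mulnCA mulnA. Qed.

Lemma expn_leq_bin m r : (m.+1 ^ r <= r`! * 'C(m + r, r))%N.
Proof.
elim: r => [|r IHr]; first by rewrite bin0.
by rewrite fact_bin_step expnS leq_mul // ltnS leq_addr.
Qed.

Lemma leq_exponent C e r :
  (forall k, k.+1 ^ e <= C * k.+1 ^ r)%N -> (e <= r)%N.
Proof.
move=> le_er; rewrite leqNgt; apply/negP => lt_re.
have := le_er C; rewrite -(subnKC lt_re) addSn expnS expnD.
have X0 : (0 < C.+1 ^ r)%N by rewrite expn_gt0.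
have Y0 : (0 < C.+1 ^ (e - r.+1))%N by rewrite expn_gt0.
nia.
Qed.

Lemma psumS r c k : psum r.+1 c k.+1 = (psum r.+1 c k + psum r c k.+1)%N.
Proof. by rewrite /= big_ord_recr. Qed.

Lemma eq_psum r c c' k : (forall i, (i <= k)%N -> c i = c' i) ->
  psum r c k = psum r c' k.
Proof.
elim: r k => [|r IHr] k cc' /=; first exact: cc'.
by apply: eq_bigr => i _; apply: IHr => j ji; apply: cc'; apply: leq_trans ji (leq_ord i).
Qed.

Lemma leq_psum r c c' k : (forall i, c i <= c' i)%N -> (psum r c k <= psum r c' k)%N.
Proof. by elim: r k => [|r IHr] k cc' //=; apply: leq_sum => i _; exact: IHr. Qed.

Lemma psum_swap r c k : psum r (psum 1 c) k = psum r.+1 c k.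
Proof. by elim: r k => // r IHr k /=; apply: eq_bigr => i _; exact: IHr. Qed.

Lemma psum_bin r c k : psum r.+1 c k = (\sum_(i < k.+1) c i * 'C(k - i + r, r))%N.
Proof.
elim: r k => [|r IHr] k; first by apply: eq_bigr => i _; rewrite bin0 muln1.
elim: k => [|k IHk]; first by rewrite -[LHS]/(\sum_(i < 1) psum r.+1 c i)%N big_ord1 IHr
  !big_ord1 !add0n !binn.
rewrite psumS IHk IHr [X in (_ + X)%N]big_ord_recr [RHS]big_ord_recr /= addnA -big_split /=.
rewrite subnn !add0n !binn; congr (_ + _)%N; apply: eq_bigr => i _.
rewrite -mulnDr subSn ?leq_ord // addSn [in RHS]addnS binS; congr (_ * _)%N.
by rewrite addnS addSn.
Qed.

Lemma psum_delta r k : psum r.+1 (fun i => (i == 0)%N : nat) k = 'C(k + r, r).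
Proof.
rewrite psum_bin big_ord_recl /= mul1n subn0 big1 ?addn0 // => i _.
Qed.

Lemma psum_geq r c k : (c 0%N * 'C(k + r, r) <= psum r.+1 c k)%N.
Proof. by rewrite psum_bin big_ord_recl /= subn0 leq_addr. Qed.

Lemma psum_bin_support r c N k : (forall i, (N < i)%N -> c i = 0%N) ->
  psum r.+1 c k = (\sum_(i < N.+1) if i <= k then c i * 'C(k - i + r, r) else 0)%N.
Proof.
move=> cN; rewrite psum_bin.
pose F i := (c i * 'C(k - i + r, r))%N.
rewrite (big_ord_widen (k + N).+1 F) ?ltnS ?leq_addr //.
rewrite (big_ord_widen (k + N).+1 (fun i => if (i <= k)%N then F i else 0%N)) ?ltnS ?leq_addl //.
rewrite big_mkcond [RHS]big_mkcond; apply: eq_bigr => i _; rewrite !ltnS.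
by have [//|Ni] := leqP i N; rewrite /F cN // mul0n if_same.
Qed.

Lemma psum_leq r c N k : (forall i, (N < i)%N -> c i = 0%N) ->
  (psum r.+1 c k <= (\sum_(i < N.+1) c i) * k.+1 ^ r)%N.
Proof.
move=> cN; rewrite (psum_bin_support _ _ cN) big_distrl /=; apply: leq_sum => i _.
case: ifP => // ik; rewrite leq_mul //; apply: leq_trans (leq_bin_expn _ _) _.
by case: (r) => [|r']; rewrite ?expn0 // leq_exp2r // ltnS leq_subr.
Qed.

(** With [c] nowhere zero, [psum r.+1 c] would grow like a polynomial of degree
    [r.+1]. *)
Lemma psum_finite_support r c C : (forall k, c k = 0 -> c k.+1 = 0)%N ->
  (forall k, psum r.+1 c k <= C * k.+1 ^ r)%N ->
  exists N, forall i, (N < i)%N -> c i = 0%N.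
Proof.
move=> c0 cC; apply: contrapT => cN.
have cpos i : (1 <= c i)%N.
  rewrite lt0n; apply/eqP => ci; apply: cN; exists i => j.
  elim: j => // j IHj; rewrite ltnS leq_eqVlt => /predU1P[<-|/IHj]; exact: c0.
suff : (r.+1 <= r)%N by rewrite ltnn.
apply: (@leq_exponent (r.+1`! * C)) => k; rewrite -mulnA.
apply: leq_trans (expn_leq_bin _ _) _; rewrite leq_mul //.
apply: leq_trans (cC k); rewrite -psum_delta -psum_swap; apply: leq_psum => i.
by rewrite /= big_ord_recl /= big1 ?addn0.
Qed.

Section HilbertPolynomial.

(** The binomial coefficient C(m + r, r) as a polynomial in [m]. *)
Definition bin_poly r : {poly rat} :=
  (r`!%:R^-1 : rat) *: \prod_(j < r) ('X + j.+1%:R%:P).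

Lemma bin_polyE r m : (bin_poly r).[m%:R] = 'C(m + r, r)%:R.
Proof.
rewrite /bin_poly hornerZ horner_prod.
have rf : (r`!%:R : rat) != 0 by rewrite Num.Theory.pnatr_eq0 -lt0n fact_gt0.
apply: (mulfI rf); rewrite mulrA mulfV // mul1r -natrM.
elim: r {rf} => [|r IHr]; first by rewrite big_ord0 bin0.
rewrite big_ord_recr /= IHr hornerD hornerX hornerC -natrD -natrM; congr _%:R.
by rewrite fact_bin_step mulnC addnS.
Qed.

Lemma monic_bin r : \prod_(j < r) ('X + j.+1%:R%:P : {poly rat}) \is monic.
Proof. by apply: monic_prod => i _; rewrite monicE lead_coefDl ?lead_coefX // size_polyX
  size_polyC; case: eqP. Qed.

Lemma size_bin_prod r : size (\prod_(j < r) ('X + j.+1%:R%:P : {poly rat})) = r.+1.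
Proof.
rewrite size_prod => [|i _]; last by rewrite -size_poly_eq0 size_XaddC.
rewrite (eq_bigr (fun=> 2%N)) => [|i _]; last by rewrite size_XaddC.
by rewrite sum_nat_const card_ord; lia.
Qed.

Lemma poly_eq_nat (P Q : {poly rat}) N :
  (forall k, (N <= k)%N -> P.[k%:R] = Q.[k%:R]) -> P = Q.
Proof.
move=> PQ; apply/eqP; rewrite -subr_eq0; apply/negPn/negP => PQ0.
pose s := [seq (i%:R : rat) | i <- iota N (size (P - Q))].
have /(max_poly_roots PQ0) : all (root (P - Q)) s.
  apply/allP => x /mapP[i]; rewrite mem_iota => /andP[Ni _] -> {x}.
  by rewrite rootE hornerD hornerN PQ // subrr.
rewrite map_inj_uniq ?iota_uniq => [/(_ isT)|i j /eqP].
  by rewrite size_map size_iota ltnn.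
by rewrite Num.Theory.eqr_nat => /eqP.
Qed.

(** The multiplicity is the value at 1 of the numerator of the Hilbert series:
    the Hilbert polynomial is the sum of the [c i] times C(m - i + r, r), and each
    of these binomials has leading coefficient [1 / r!]. *)
Lemma multiplicity_psum (K : fieldType) (A : comAlgType K) (G : nat -> set A) r c N :
  krull_dim A = r.+1 -> (forall k, hilbert_function G k = psum r.+1 c k) ->
  (forall i, (N < i)%N -> c i = 0%N) -> c 0%N != 0%N ->
  multiplicity G = (\sum_(i < N.+1) c i)%:R.
Proof.
move=> dimA hc cN c0; rewrite /multiplicity dimA.
pose P : {poly rat} := \sum_(i < N.+1) (c i)%:R *: (bin_poly r \Po ('X - i%:R%:P)).
have PE k : (N <= k)%N -> (hilbert_function G k)%:R = P.[k%:R].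
  move=> Nk; rewrite hc (psum_bin_support _ _ cN) horner_sum natr_sum.
  apply: eq_bigr => i _; have ik : (i <= k)%N := leq_trans (leq_ord i) Nk.
  rewrite ik hornerZ horner_comp hornerD hornerN hornerX hornerC -natrB //.
  by rewrite bin_polyE natrM.
have -> : hilbert_polynomial G = P.
  rewrite /hilbert_polynomial; case: xgetP => [Q _ [M QE]|/(_ P)]; last first.
    by case; exists N.
  apply: (@poly_eq_nat _ _ (maxn M N)) => k; rewrite geq_max => /andP[Mk Nk].
  by rewrite -PE // -QE.
have binr : (bin_poly r)`_r = r`!%:R^-1.
  rewrite coefZ; have := monic_bin r.
  by rewrite monicE lead_coefE size_bin_prod => /eqP ->; rewrite mulr1.
have r0 : (r`!%:R : rat) != 0 by rewrite Num.Theory.pnatr_eq0 -lt0n fact_gt0.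
have size_bin : size (bin_poly r) = r.+1.
  by rewrite size_scale ?invr_eq0 ?size_bin_prod.
have sizeP i : size (bin_poly r \Po ('X - i%:R%:P)) = r.+1.
  by rewrite size_comp_poly2 ?size_XsubC.
have lcP i : (bin_poly r \Po ('X - i%:R%:P))`_r = r`!%:R^-1.
  rewrite -[r in _`_r]/r.+1.-1 -(sizeP i) -lead_coefE lead_coef_comp ?size_XsubC //.
  by rewrite lead_coefXsubC expr1n mulr1 lead_coefE size_bin.
have Pr : P`_r = (\sum_(i < N.+1) c i)%:R / r`!%:R.
  rewrite coef_sum natr_sum mulr_suml; apply: eq_bigr => i _.
  by rewrite coefZ lcP.
have sc : ((\sum_(i < N.+1) c i)%:R : rat) != 0.
  by rewrite Num.Theory.pnatr_eq0 big_ord_recl addn_eq0 negb_and c0.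
rewrite lead_coefE (_ : size P = r.+1) ?Pr /=; first by rewrite mulrC divfK.
apply/eqP; rewrite eqn_leq; apply/andP; split.
  apply/leq_sizeP => j rj; rewrite coef_sum big1 // => i _.
  by rewrite coefZ nth_default ?mulr0 // sizeP.
by rewrite ltnNge; apply/negP => /leq_sizeP/(_ _ (leqnn r))/eqP;
  rewrite Pr mulf_eq0 invr_eq0 (negPf sc) (negPf r0).
Qed.

End HilbertPolynomial.

(** * Chains of primes and growth *)

Lemma nat_max_eq (P : nat -> Prop) d :
  P d -> (forall e, P e -> (e <= d)%N) -> nat_max P = d.
Proof.
move=> Pd dP; rewrite /nat_max; case: xgetP => [e _ [Pe eP]|/(_ d)]; last by case.
by apply/eqP; rewrite eqn_leq dP // eP.
Qed.

Lemma nat_max_pos (P : nat -> Prop) d : nat_max P = d.+1 -> P d.+1.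
Proof. by rewrite /nat_max; case: xgetP => // e _ [Pe _] <-. Qed.

Lemma nat_min_eq (P : nat -> Prop) d :
  P d -> (forall e, P e -> (d <= e)%N) -> nat_min P = d.
Proof.
move=> Pd dP; rewrite /nat_min; case: xgetP => [e _ [Pe eP]|/(_ d)]; last by case.
by apply/eqP; rewrite eqn_leq dP // eP.
Qed.

Definition prime_chain (R : comNzRingType) d (P : nat -> set R) :=
  (forall i, (i <= d)%N -> is_prime_ideal (P i)) /\
  (forall i, (i < d)%N -> P i `<` P i.+1).

Section Growth.
Variables (K : fieldType) (A : comAlgType K).
Local Notation sigma := (in_alg A).
Local Notation zero_ideal := [set (0 : A)].

Lemma zero_ideal_ideal (R : comNzRingType) : is_ideal [set (0 : R)].
Proof. by split=> [//|a b -> ->|r a ->] /=; rewrite ?addr0 ?mulr0. Qed.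
Local Notation Z0 := (zero_ideal_ideal A).

Variable U : nat -> seq A.
Hypothesis U1 : 1 \in U 0%N.
Hypothesis UM : forall i j x y, x \in U i -> y \in U j -> x * y \in U (i + j)%N.
Hypothesis Uspan : forall x, exists k,
  depends sigma zero_ideal (flatten [seq U i | i <- iota 0 k]) x.

Definition filtration k : seq A := flatten [seq U i | i <- iota 0 k.+1].

Lemma mem_filtration k x : reflect (exists2 i, (i <= k)%N & x \in U i) (x \in filtration k).
Proof.
apply: (iffP flatten_mapP) => [[i]|[i ik xi]]; last by exists i; rewrite // mem_iota.
by rewrite mem_iota => /= ik xi; exists i.
Qed.

Local Notation inV k := (depends sigma zero_ideal (filtration k)).

Lemma inV_le k l x : (k <= l)%N -> inV k x -> inV l x.
Proof.
move=> kl; apply: depends_trans => [|y /mem_filtration[i ik yi]]; first exact: Z0.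
apply: depends_mem; first exact: Z0.
by apply/mem_filtration; exists i => //; exact: leq_trans kl.
Qed.

Lemma depends_map_mul (b : seq A) g x : depends sigma zero_ideal b x ->
  depends sigma zero_ideal (map ( *%R g) b) (g * x).
Proof.
move=> [s s0 [c e]]; exists s => //; exists c; rewrite lincomb_mul mulrCA -mulrBr.
by rewrite e /= mulr0.
Qed.

Lemma inV_mul k l x y : inV k x -> inV l y -> inV (k + l)%N (x * y).
Proof.
move=> xV /(depends_map_mul x); apply: depends_trans => [|_ /mapP[v /mem_filtration[j jl vj] ->]].
  exact: Z0.
rewrite mulrC; move: xV => /(depends_map_mul v); apply: depends_trans =>
  [|_ /mapP[u /mem_filtration[i ik ui] ->]].
  exact: Z0.
apply: depends_mem; first exact: Z0.
apply/mem_filtration; exists (j + i)%N; last exact: UM.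
by rewrite addnC leq_add.
Qed.

Lemma inV_exists x : exists k, inV k x.
Proof.
have [k xk] := Uspan x; exists k; apply: depends_trans xk => [|y]; first exact: Z0.
move=> /flatten_mapP[i]; rewrite mem_iota /= add0n => ik yi; apply: depends_mem; first exact: Z0.
by apply/mem_filtration; exists i => //; exact: ltnW.
Qed.

(** The mechanism behind the bound on the Krull dimension. If [a] lies in
    [P 1] but not in [P 0] and [b] is independent modulo [P 1], then
    [b], [a b], [a^2 b], ... are independent modulo [P 0]: each step down a
    chain of primes raises the growth exponent by one. *)
Lemma prime_chain_independent d (P : nat -> set A) : prime_chain d P ->
  exists s, forall J, exists b, [/\ size b = (J ^ d)%N,
    forall x, x \in b -> inV (s * J)%N x & independent sigma (P 0%N) b].
Proof.
elim: d P => [|d IHd] P [Pprime Pstrict].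
  exists 0%N => J; exists [:: 1]; split=> //.
    move=> x; rewrite inE => /eqP ->; rewrite mul0n; apply: depends_mem; first exact: Z0.
    by apply/mem_filtration; exists 0%N.
  have [[P0 PD PM] P1 _] := Pprime 0%N isT.
  move=> c; rewrite lincomb_cons /lincomb big_ord0 addr0 mulr1 => Pc [|//] _.
  apply/eqP/negPn/negP => c0; apply: P1.
  by rewrite -(scale1r 1) -(mulVf c0) -scalerA -mulr_algl; exact: PM.
have [|s IHs] := IHd (P \o succn).
  by split=> i id; [apply: Pprime | apply: Pstrict].
have P0prime := Pprime 0%N isT; have P1prime := Pprime 1%N isT.
have [P01 nP10] := Pstrict 0%N isT.
have [a [P1a nP0a]] : exists a, P 1%N a /\ ~ P 0%N a.
  apply: contrapT => na; apply: nP10 => x P1x; apply: contrapT => nP0x.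
  by apply: na; exists x.
have [t ta] := inV_exists a.
exists (s + t)%N => J; have [b [sb bV bI]] := IHs J.
suff [b' [sb' b'V b'I]] : exists b', [/\ size b' = (J * size b)%N,
    forall x, x \in b' -> inV (s * J + J * t)%N x & independent sigma (P 0%N) b'].
  exists b'; split=> //; first by rewrite sb' sb expnS.
  by rewrite mulnDl [(t * J)%N]mulnC.
elim: {1 3}J => [|m [b' [sb' b'V b'I]]]; first by exists [::]; split=> // c _ [].
exists (b ++ map ( *%R a) b'); split.
- by rewrite size_cat size_map sb' mulSn.
- move=> x; rewrite mem_cat => /orP[/bV|/mapP[y /b'V yV ->]].
    by apply: inV_le; exact: leq_addr.
  by rewrite mulSn addnCA; exact: inV_mul.
have [[P00 P0D P0M] _ P0P] := P0prime; have [P1i _ _] := P1prime.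
move=> c; rewrite lincomb_cat lincomb_mul => Pc.
have cb i : (i < size b)%N -> c i = 0.
  move=> ib; apply: (bI c) => //=.
  apply: (ideal_congr P1i (y := - (a * lincomb sigma (fun i => c (size b + i)%N) b'))).
    by rewrite opprK; exact: P01.
  by apply: idealN => //; rewrite mulrC; exact: idealMl.
have cb' i : (i < size b')%N -> c (size b + i)%N = 0.
  move=> ib; apply: (b'I (fun i => c (size b + i)%N)) => //.
  have e : lincomb sigma c b = 0.
    by rewrite /lincomb big1 // => j _; rewrite cb // rmorph0 mul0r.
  by move: Pc; rewrite e add0r => /P0P[].
move=> i; rewrite size_cat size_map; have [/cb //|le_i] := ltnP i (size b).
by rewrite -ltn_subLR // => /cb'; rewrite subnKC.
Qed.

(** With [J = k + 1], [prime_chain_independent] gives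
    J^d <= C (s J + 1)^r <= C (s + 1)^r J^r for all [J]. *)
Lemma prime_chain_growth C r d (P : nat -> set A) :
  (forall k, size (filtration k) <= C * k.+1 ^ r)%N -> prime_chain d P -> (d <= r)%N.
Proof.
move=> LC dP; have [s sP] := prime_chain_independent dP.
apply: (@leq_exponent (C * s.+1 ^ r)) => k; have [b [<- bV bI]] := sP k.+1.
have bI0 : independent sigma zero_ideal b.
  move=> c e; apply: bI; rewrite e.
  by case: dP => /(_ 0%N isT)[[]].
have := independent_size Z0 bI0 bV; move/leq_trans; apply.
apply: leq_trans (LC _) _; rewrite -mulnA leq_mul // -expnMn.
by case: (r) => [|r']; rewrite ?expn0 // leq_exp2r //; nia.
Qed.

Lemma krull_dim_growth C r (P : nat -> set A) :
  (forall k, size (filtration k) <= C * k.+1 ^ r)%N -> prime_chain r P ->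
  krull_dim A = r.
Proof.
move=> LC Pr; apply: nat_max_eq; first by exists P.
by move=> e [Q Qe]; exact: (prime_chain_growth LC Qe).
Qed.

End Growth.

(** * Monomial ideals generated in one degree *)

Section MonomialIdeals.
Variables (K : fieldType) (n : nat).
Local Notation S := {mpoly K[n]}.
Local Notation mon := 'X_{1..n}.

Definition monideal (W : seq mon) : set S :=
  [set p | forall m, m \in msupp p -> exists2 w, w \in W & (w <= m)%MM].

(** The polynomials of order at least [e], that is the [e]-th power of the
    maximal ideal. *)
Definition order_ideal e : set S :=
  [set p | forall m, m \in msupp p -> (e <= mdeg m)%N].

Lemma support_ideal (Q : mon -> Prop) : (forall m m', Q m -> Q (m' + m)%MM) ->
  is_ideal [set p : S | forall m, m \in msupp p -> Q m].
Proof.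
move=> Qup; split=> [m|p q pQ qQ m /msuppD_le|r p pQ m /msuppM_le].
- by rewrite msupp0.
- by rewrite mem_cat => /orP[/pQ|/qQ].
by move=> /allpairsP[[m1 m2] [_ /pQ m2Q ->]]; exact: Qup.
Qed.

Lemma monideal_ideal W : is_ideal (monideal W).
Proof.
apply: support_ideal => m m' [w wW wm]; exists w => //.
by apply: lepm_trans wm _; rewrite lem_addl.
Qed.

Lemma order_ideal_ideal e : is_ideal (order_ideal e).
Proof. by apply: support_ideal => m m' em; rewrite mdegD; apply: leq_trans em _;
  exact: leq_addl. Qed.

Lemma ideal_mpolyE (I : set S) p : is_ideal I ->
  (forall m, m \in msupp p -> I 'X_[m]) -> I p.
Proof.
move=> II pI; rewrite [p]mpolyE; apply: ideal_sum_seq => // m mp.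
by rewrite -mul_mpolyC; apply: idealMl => //; exact: pI.
Qed.

Lemma ideal_gen_monomials W :
  ideal_gen [set 'X_[m] | m in [set` W]] = monideal W.
Proof.
apply/seteqP; split.
  apply: ideal_gen_min => [|_ [w wW <-] m]; first exact: monideal_ideal.
  by rewrite msuppX inE => /eqP ->; exists w => //; exact: lepm_refl.
have II := ideal_gen_ideal [set ('X_[m] : S) | m in [set` W]].
move=> p pW; apply: ideal_mpolyE => // m /pW[w wW wm].
rewrite -(submK wm) mpolyXD; apply: idealMl => //; apply: ideal_gen_sub.
by exists w.
Qed.

Lemma order_idealM e f p q : order_ideal e p -> order_ideal f q ->
  order_ideal (e + f) (p * q).
Proof.
move=> pe qf m /msuppM_le /allpairsP[[m1 m2] [/pe e1 /qf f2 ->]].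
by rewrite mdegD leq_add.
Qed.

Definition deg_part e (p : S) : S := pihomog mdeg e p.

Lemma mcoeff_deg_part e p m : (deg_part e p)@_m = if mdeg m == e then p@_m else 0.
Proof.
rewrite /deg_part pihomogE raddf_sum /=.
under eq_bigr do rewrite mcoeffZ mcoeffX.
have [mp|mNp] := boolP (m \in msupp p).
  rewrite big_mkcond (bigD1_seq m) ?msupp_uniq //= eqxx mulr1 big1 ?addr0 // => i /negPf ->.
  by rewrite mulr0 if_same.
rewrite (memN_msupp_eq0 mNp) if_same big_seq_cond big1 // => i /andP[ip _].
case: eqP => [eim|_]; last by rewrite mulr0.
by rewrite -eim ip in mNp.
Qed.

Lemma deg_partD e : {morph deg_part e : p q / p + q}.
Proof. exact: pihomogD. Qed.

Lemma deg_part0 e : deg_part e 0 = 0. Proof. exact: pihomog0. Qed.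

Lemma deg_part_sum e (T : Type) (r : seq T) (P : pred T) (F : T -> S) :
  deg_part e (\sum_(i <- r | P i) F i) = \sum_(i <- r | P i) deg_part e (F i).
Proof. exact: (big_morph _ (deg_partD e) (deg_part0 e)). Qed.

Lemma deg_part_order e f p : (e < f)%N -> order_ideal f p -> deg_part e p = 0.
Proof.
move=> ef pf; apply/mpolyP => m; rewrite mcoeff_deg_part mcoeff0.
case: eqP => // em; apply: memN_msupp_eq0; apply/negP => /pf.
by rewrite em leqNgt ef.
Qed.

Lemma deg_part_homog e p : p \is e.-homog -> deg_part e p = p.
Proof. exact: pihomog_dE. Qed.

Lemma order_sub_deg_part e p : order_ideal e p -> order_ideal e.+1 (p - deg_part e p).
Proof.
move=> pe m; rewrite mcoeff_msupp mcoeffB mcoeff_deg_part.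
case: ifP => [_|em]; first by rewrite subrr eqxx.
by rewrite subr0 -mcoeff_msupp => /pe; rewrite leq_eqVlt eq_sym em.
Qed.

Lemma homog_order e p : p \is e.-homog -> order_ideal e p.
Proof. by move=> /dhomogP pe m /pe /= ->. Qed.

(** Initial forms multiply. *)
Lemma deg_partM e f p q : order_ideal e p -> order_ideal f q ->
  deg_part (e + f) (p * q) = deg_part e p * deg_part f q.
Proof.
move=> pe qf; have pl := pihomogP mdeg e p; have ql := pihomogP mdeg f q.
have -> : p * q = deg_part e p * deg_part f q + (deg_part e p * (q - deg_part f q)
  + (p - deg_part e p) * q).
  by ring.
rewrite deg_partD (deg_part_homog (dhomogM pl ql)) (@deg_part_order _ (e + f).+1) ?addr0 //.
case: (order_ideal_ideal (e + f).+1) => _ OD _; apply: OD.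
  rewrite -addnS; apply: order_idealM; last exact: order_sub_deg_part.
  exact: homog_order.
by rewrite -addSn; apply: order_idealM => //; exact: order_sub_deg_part.
Qed.

(** A monomial ideal contains every monomial of each of its elements, so the
    monomials that occur in homogeneous generators of degree [d] generate it. *)
Lemma equigenerated_monomials (I : set S) : monomial_ideal I -> equigenerated I ->
  exists (v : seq mon) d, (forall m, m \in v -> mdeg m = d) /\
    I = ideal_gen [set 'X_[m] | m in [set` v]].
Proof.
move=> [M defI] [s [d [[defIs _] sd]]].
have supI p m : I p -> m \in msupp p -> I 'X_[m].
  have IM : is_ideal [set p : S | forall m, m \in msupp p -> I 'X_[m]].
    apply: support_ideal => m1 m2 Im; rewrite mpolyXD defI.
    by apply: idealMl; [exact: ideal_gen_ideal | rewrite -defI].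
  move=> Ip; move: p Ip m; rewrite {1}defI; apply: ideal_gen_min => //.
  move=> _ [m0 Mm0 <-] m; rewrite msuppX inE => /eqP ->.
  by rewrite defI; apply: ideal_gen_sub; exists m0.
pose v := flatten [seq (msupp f : seq mon) | f <- s].
have sI f : f \in s -> I f by move=> fs; rewrite defIs; exact: ideal_gen_sub.
exists v, d; split.
  by move=> m /flatten_mapP[f /sd /dhomogP fd /fd].
have II : is_ideal I by rewrite defI; exact: ideal_gen_ideal.
apply/seteqP; split; last first.
  apply: ideal_gen_min => // _ [m /flatten_mapP[f /sI If mf] <-].
  exact: supI mf.
have IV := ideal_gen_ideal [set ('X_[m] : S) | m in [set` v]].
rewrite {1}defIs; apply: ideal_gen_min => // f fs.
apply: ideal_mpolyE => // m mf; apply: ideal_gen_sub; exists m => //.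
by apply/flatten_mapP; exists f.
Qed.

End MonomialIdeals.

Section Powers.
Variables (K : fieldType) (n : nat) (v : seq 'X_{1..n}) (d : nat).
Hypothesis vd : forall m, m \in v -> mdeg m = d.
Local Notation S := {mpoly K[n]}.
Local Notation I := (ideal_gen [set ('X_[m] : S) | m in [set` v]]).

(** The exponents of the products of [k] generators, without repetitions. *)
Fixpoint sums k : seq 'X_{1..n} :=
  if k is k'.+1 then undup [seq (u + w)%MM | u <- v, w <- sums k'] else [:: 0%MM].

Lemma sums_uniq k : uniq (sums k).
Proof. by case: k => // k; exact: undup_uniq. Qed.

Lemma mem_sumsS k m :
  reflect (exists u w, [/\ u \in v, w \in sums k & m = (u + w)%MM]) (m \in sums k.+1).
Proof.
rewrite mem_undup; apply: (iffP allpairsP) => [[[u w] [uv wk ->]]|[u [w [uv wk ->]]]].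
  by exists u, w.
by exists (u, w).
Qed.

Lemma mem_sums1 m : (m \in sums 1) = (m \in v).
Proof.
apply/mem_sumsS/idP => [[u [w [uv]]]|mv]; last by exists m, 0%MM; rewrite addm0 inE eqxx.
by rewrite inE => /eqP -> ->; rewrite addm0.
Qed.

Lemma mdeg_sums k m : m \in sums k -> mdeg m = (k * d)%N.
Proof.
elim: k m => [|k IHk] m; first by rewrite inE => /eqP ->; rewrite mdeg0.
by move=> /mem_sumsS[u [w [/vd ud /IHk wd ->]]]; rewrite mdegD ud wd mulSn.
Qed.

Lemma sumsD i j u w : u \in sums i -> w \in sums j -> (u + w)%MM \in sums (i + j)%N.
Proof.
elim: i u => [|i IHi] u; first by rewrite inE => /eqP ->; rewrite add0m.
move=> /mem_sumsS[u1 [u2 [u1v u2i ->]]] wj; rewrite addSn; apply/mem_sumsS.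
by exists u1, (u2 + w)%MM; rewrite addmA; split=> //; exact: IHi.
Qed.

Lemma ideal_exp_sums k : ideal_exp I k = @monideal K n (sums k).
Proof.
elim: k => [|k IHk].
  apply/seteqP; split=> // p _ m _; exists 0%MM; rewrite ?inE //.
  by apply/mnm_lepP => i; rewrite mnmE.
rewrite -[LHS]/(ideal_mul I (ideal_exp I k)) IHk ideal_gen_monomials.
apply/seteqP; split.
  apply: ideal_gen_min => [|_ [p [q [pv qk ->]]] m /msuppM_le]; first exact: monideal_ideal.
  move=> /allpairsP[[m1 m2] [/pv[u uv um] /qk[w wk wm] ->]] /=.
  exists (u + w)%MM; first by apply/mem_sumsS; exists u, w.
  apply/mnm_lepP => i; rewrite !mnmDE; move/mnm_lepP: um => /(_ i); move/mnm_lepP: wm => /(_ i).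
  by move=> a b; exact: leq_add.
rewrite -ideal_gen_monomials; apply: ideal_gen_min; first exact: ideal_gen_ideal.
move=> _ [_ /mem_sumsS[u [w [uv wk ->]]] <-]; rewrite mpolyXD; apply: ideal_gen_sub.
exists 'X_[u], 'X_[w]; split=> //.
  by move=> m; rewrite msuppX inE => /eqP ->; exists u => //; exact: lepm_refl.
by move=> m; rewrite msuppX inE => /eqP ->; exists w => //; exact: lepm_refl.
Qed.

Lemma monideal_order k p : @monideal K n (sums k) p -> @order_ideal K n (k * d) p.
Proof.
move=> pk m /pk[w /mdeg_sums <- wm].
by rewrite -(submK wm) mdegD leq_addl.
Qed.

Lemma msupp_deg_part_sums k p : @monideal K n (sums k) p ->
  {subset msupp (deg_part (k * d) p) <= sums k}.
Proof.
move=> pk m; rewrite mcoeff_msupp mcoeff_deg_part; case: ifP => [/eqP dm|_]; last by rewrite eqxx.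
rewrite -mcoeff_msupp => /pk[w wk wm].
suff -> : m = w by [].
rewrite -(submK wm); move: dm; rewrite -{1}(submK wm) mdegD (mdeg_sums wk) => /eqP.
by rewrite -[X in _ == X]add0n eqn_add2r mdeg_eq0 => /eqP ->; rewrite add0m.
Qed.

Lemma max_ideal_order : @max_ideal K n `<=` @order_ideal K n 1.
Proof.
apply: ideal_gen_min => [|_ [i _ <-] m]; first exact: order_ideal_ideal.
by rewrite msuppX inE => /eqP ->; rewrite mdeg1.
Qed.

Lemma max_ideal_X m : m != 0%MM -> @max_ideal K n 'X_[m].
Proof.
move=> m0; have /existsP[i mi] : [exists i, m i != 0%N].
  apply: contraNT m0 => /existsPn m0; apply/eqP/mnmP => i; rewrite mnmE.
  by apply/eqP; rewrite -[_ == _]negbK.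
have im : (U_(i) <= m)%MM.
  by apply/mnm_lepP => j; rewrite mnm1E; case: eqP => // <-; rewrite lt0n.
rewrite -(submK im) mpolyXD; apply: idealMl; first exact: ideal_gen_ideal.
by apply: ideal_gen_sub; exists i.
Qed.

(** An element of [I^k] has order at least [k d], and its terms of degree [k d]
    are exactly those that are not in [m I^k]: a monomial of larger degree is a
    proper multiple of a generator of [I^k]. *)
Lemma max_mul_power k p : ideal_exp I k p ->
  (ideal_mul (@max_ideal K n) (ideal_exp I k) p <-> deg_part (k * d) p = 0).
Proof.
move=> pk; split=> [pm|p0].
  apply: (@deg_part_order _ _ _ (k * d).+1) => //; move: p pm {pk}.
  apply: ideal_gen_min => [|_ [x [y [xm yk ->]]]]; first exact: order_ideal_ideal.
  rewrite -add1n; apply: order_idealM; first exact: max_ideal_order.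
  by apply: monideal_order; rewrite -ideal_exp_sums.
rewrite ideal_exp_sums in pk *.
apply: ideal_mpolyE => [|m mp]; first exact: ideal_gen_ideal.
have [w wk wm] := pk m mp; rewrite -(submK wm) mpolyXD; apply: ideal_gen_sub.
exists 'X_[m - w], 'X_[w]; split=> //.
  apply: max_ideal_X; apply: contraTneq mp => mw.
  have em : m = w by rewrite -(submK wm) mw add0m.
  have := congr1 (mcoeff m) p0; rewrite mcoeff_deg_part mcoeff0 em (mdeg_sums wk) eqxx.
  by rewrite -em mcoeff_msupp => ->; rewrite eqxx.
by move=> m'; rewrite msuppX inE => /eqP ->; exists w => //; exact: lepm_refl.
Qed.

End Powers.

(** * The fiber cone as a ring of polynomials *)

Section FiberConeModel.
Variables (K : fieldType) (n : nat) (v : seq 'X_{1..n}) (d : nat).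
Hypothesis vd : forall m, m \in v -> mdeg m = d.
Local Notation S := {mpoly K[n]}.
Variable I : set S.
Hypothesis defI : I = ideal_gen [set ('X_[m] : S) | m in [set` v]].
Local Notation W := (sums v).
Local Notation F := (fiber_cone I).
Local Notation piF := (\pi_({ideal_quot (@max_rees K n I)})).

Lemma ideal_exp_monideal k : ideal_exp I k = @monideal K n (W k).
Proof. by rewrite defI ideal_exp_sums. Qed.

Lemma rees_coefP (p : rees I) k : @monideal K n (W k) (rees_val p)`_k.
Proof. by rewrite -ideal_exp_monideal; case: p => p /= /asboolP. Qed.

Definition initial_form (p : {poly S}) : {poly S} :=
  \poly_(k < size p) deg_part (k * d) p`_k.

Lemma coef_initial_form p k : (initial_form p)`_k = deg_part (k * d) p`_k.
Proof.
rewrite coef_poly; case: ltnP => // kp.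
by rewrite nth_default // deg_part0.
Qed.

Lemma initial_formD p q : initial_form (p + q) = initial_form p + initial_form q.
Proof. by apply/polyP => k; rewrite coefD !coef_initial_form coefD deg_partD. Qed.

Lemma initial_formM (p q : rees I) :
  initial_form (rees_val p * rees_val q) =
  initial_form (rees_val p) * initial_form (rees_val q).
Proof.
apply/polyP => k; rewrite coef_initial_form !coefM deg_part_sum; apply: eq_bigr => i _.
rewrite !coef_initial_form -(deg_partM (monideal_order vd (@rees_coefP p i))
  (monideal_order vd (@rees_coefP q (k - i)%N))).
by rewrite -mulnDl subnKC ?leq_ord.
Qed.

Lemma initial_form_eq0 (p : rees I) : (p \in @max_rees K n I) = (initial_form (rees_val p) == 0).
Proof.
have mulP k (q : S) : ideal_exp I k q ->
    (ideal_mul (@max_ideal K n) (ideal_exp I k) q <-> deg_part (k * d) q = 0).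
  by rewrite defI; exact: max_mul_power.
have pI k : ideal_exp I k (rees_val p)`_k by rewrite ideal_exp_monideal; exact: rees_coefP.
apply/asboolP/eqP => [pm|p0 k].
  by apply/polyP => k; rewrite coef_initial_form coef0; apply/mulP.
by apply/mulP => //; rewrite -coef_initial_form p0 coef0.
Qed.

(** The fiber cone as an algebra of polynomials: the class of [p] is read off
    the initial forms of the coefficients of [p]. *)
Definition fiber_poly (x : F) : {poly S} := initial_form (rees_val (repr x)).

Lemma fiber_poly_pi (p : rees I) : fiber_poly (piF p) = initial_form (rees_val p).
Proof.
apply/eqP; rewrite -subr_eq0 /fiber_poly.
set q := repr _; have /eqP : piF q = piF p by rewrite reprK.
rewrite -Quotient.idealrBE initial_form_eq0 => /eqP e.
have -> : rees_val q = rees_val (q - p) + rees_val p by rewrite -[X in rees_val X = _](subrK p).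
by rewrite initial_formD e add0r subrr.
Qed.

Lemma fiber_polyD x y : fiber_poly (x + y) = fiber_poly x + fiber_poly y.
Proof.
rewrite -[x]reprK -[y]reprK; have -> : piF (repr x) + piF (repr y) = piF (repr x + repr y)
  by rewrite rmorphD.
by rewrite !fiber_poly_pi initial_formD.
Qed.

Lemma fiber_polyM x y : fiber_poly (x * y) = fiber_poly x * fiber_poly y.
Proof.
rewrite -[x]reprK -[y]reprK; have -> : piF (repr x) * piF (repr y) = piF (repr x * repr y)
  by rewrite rmorphM.
by rewrite !fiber_poly_pi initial_formM.
Qed.

Lemma deg_part_C e c : deg_part e (c%:MP : S) = if e == 0%N then c%:MP else 0.
Proof.
apply/mpolyP => m; rewrite mcoeff_deg_part !(fun_if (mcoeff m)) mcoeffC mcoeff0.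
have [->|m0] := eqVneq m 0%MM; first by rewrite mdeg0 eq_sym; case: eqP.
rewrite mulr0 !if_same //.
Qed.

Lemma fiber_poly1 : fiber_poly 1 = 1.
Proof.
have -> : (1 : F) = piF 1 by rewrite rmorph1.
rewrite fiber_poly_pi; apply/polyP => k; rewrite coef_initial_form !coef1.
by case: k => [|k]; rewrite ?deg_part0 // mul0n -[1]/(1%:MP) deg_part_C.
Qed.

Lemma fiber_poly0 : fiber_poly 0 = 0.
Proof. by apply: (addrI (fiber_poly 0)); rewrite -fiber_polyD !addr0. Qed.

Lemma fiber_polyZ c x : fiber_poly (c *: x) = (c%:MP)%:P * fiber_poly x.
Proof.
rewrite -[x]reprK -[_ *: _]/(alg_quot_scale _ _) alg_quot_scale_pi !fiber_poly_pi.
apply/polyP => k; rewrite coefCM !coef_initial_form coefZ.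
apply/mpolyP => m; rewrite mcoeff_deg_part !mul_mpolyC !mcoeffZ mcoeff_deg_part.
by case: ifP; rewrite ?mulr0.
Qed.

Lemma fiber_polyN x : fiber_poly (- x) = - fiber_poly x.
Proof. by apply: (addrI (fiber_poly x)); rewrite -fiber_polyD !subrr fiber_poly0. Qed.

Lemma fiber_polyB x y : fiber_poly (x - y) = fiber_poly x - fiber_poly y.
Proof. by rewrite fiber_polyD fiber_polyN. Qed.

Lemma fiber_poly_sum (T : Type) (r : seq T) (P : pred T) (f : T -> F) :
  fiber_poly (\sum_(i <- r | P i) f i) = \sum_(i <- r | P i) fiber_poly (f i).
Proof. exact: (big_morph _ fiber_polyD fiber_poly0). Qed.

Lemma fiber_poly_inj : injective fiber_poly.
Proof.
move=> x y e; apply/eqP; rewrite -subr_eq0; apply/eqP.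
have : fiber_poly (x - y) = 0 by rewrite fiber_polyB e subrr.
rewrite -[x - y]reprK fiber_poly_pi => /eqP; rewrite -initial_form_eq0 => r0.
have : piF (repr (x - y)) == piF 0 by rewrite -Quotient.idealrBE subr0.
by move/eqP ->; rewrite rmorph0.
Qed.

Lemma fiber_poly_supp x k : {subset msupp (fiber_poly x)`_k <= W k}.
Proof. by rewrite coef_initial_form; apply: msupp_deg_part_sums => //; exact: rees_coefP. Qed.

Lemma fiber_poly_surj (p : {poly S}) : (forall k, {subset msupp p`_k <= W k}) ->
  exists x, fiber_poly x = p.
Proof.
move=> pW; have pR : p \in rees_pred I.
  apply/asboolP => k; rewrite ideal_exp_monideal => m /pW mk.
  by exists m => //; exact: lepm_refl.
exists (piF (Rees pR)); rewrite fiber_poly_pi; apply/polyP => k; rewrite coef_initial_form /=.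
by apply: deg_part_homog; apply/dhomogP => m /pW; exact: mdeg_sums.
Qed.

Lemma fiber_gradingP k x : fiber_grading I k x <-> fiber_poly x = (fiber_poly x)`_k *: 'X^k.
Proof.
split=> [[p pk <-]|e].
  rewrite fiber_poly_pi; apply/polyP => j; rewrite coefZ coefXn !coef_initial_form.
  case: eqP => [->|/eqP jk]; rewrite ?mulr1 // mulr0 pk ?deg_part0 //.
have pR : fiber_poly x \in rees_pred I.
  apply/asboolP => j; rewrite ideal_exp_monideal => m /fiber_poly_supp mj.
  by exists m => //; exact: lepm_refl.
exists (Rees pR).
  by move=> j jk /=; rewrite e coefZ coefXn (negPf jk) mulr0.
apply: fiber_poly_inj; rewrite fiber_poly_pi /=; apply/polyP => j; rewrite coef_initial_form.
by apply: deg_part_homog; apply/dhomogP => m /fiber_poly_supp; exact: mdeg_sums.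
Qed.

(** The class of [X_w t^k], for [w] in [sums v k]. *)
Definition fiber_mono k w : F := xget 0 [set x | fiber_poly x = 'X_[w] *: 'X^k].

Lemma fiber_poly_mono k w : w \in W k -> fiber_poly (fiber_mono k w) = 'X_[w] *: 'X^k.
Proof.
move=> wk; rewrite /fiber_mono; case: xgetP => // noM.
have [|x /noM //] := @fiber_poly_surj ('X_[w] *: 'X^k).
move=> j m; rewrite coefZ coefXn; case: eqP => [->|_].
  by rewrite mulr1 msuppX inE => /eqP ->.
by rewrite mulr0 msupp0.
Qed.

Lemma fiber_mono1 : fiber_mono 0 0%MM = 1.
Proof. by apply: fiber_poly_inj; rewrite fiber_poly_mono ?inE // fiber_poly1 mpolyX0 scale1r. Qed.

Lemma fiber_monoM i j u w : u \in W i -> w \in W j ->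
  fiber_mono i u * fiber_mono j w = fiber_mono (i + j) (u + w)%MM.
Proof.
move=> ui wj; apply: fiber_poly_inj; rewrite fiber_polyM !fiber_poly_mono ?sumsD //.
by rewrite mpolyXD exprD -scalerAl -scalerAr scalerA.
Qed.

Definition fiber_proj k (x : F) : F := \sum_(w <- W k) ((fiber_poly x)`_k)@_w *: fiber_mono k w.

Lemma fiber_poly_proj k x : fiber_poly (fiber_proj k x) = (fiber_poly x)`_k *: 'X^k.
Proof.
rewrite fiber_poly_sum; under eq_big_seq => w wk do rewrite fiber_polyZ fiber_poly_mono //.
rewrite -[RHS]mul_polyC [in RHS](mpolyE (fiber_poly x)`_k) rmorph_sum mulr_suml.
rewrite (bigID (mem (msupp (fiber_poly x)`_k))) /= [X in _ + X]big1 ?addr0 => [|w]; last first.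
  by move/memN_msupp_eq0 ->; rewrite mpolyC0 mul0r.
rewrite -big_filter.
under [RHS]eq_bigr => m _ do rewrite -mul_mpolyC rmorphM -mulrA [_%:P * 'X^k]mul_polyC.
apply: perm_big; apply: uniq_perm; rewrite ?filter_uniq ?sums_uniq ?msupp_uniq //.
by move=> m; rewrite mem_filter /= andb_idr //; exact: fiber_poly_supp.
Qed.

Lemma fiber_grading_proj k x : fiber_grading I k x <-> fiber_proj k x = x.
Proof.
rewrite fiber_gradingP -fiber_poly_proj; split=> [/fiber_poly_inj <- //|e].
by rewrite e.
Qed.

Lemma fiber_proj_sum x : x = \sum_(k < size (fiber_poly x)) fiber_proj k x.
Proof.
apply: fiber_poly_inj; rewrite fiber_poly_sum; under eq_bigr do rewrite fiber_poly_proj.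
by rewrite -poly_def coefK.
Qed.

Lemma fiber_projections : grading_projections (in_alg F) fiber_proj.
Proof.
split=> [k x y|k c x|k x]; apply: fiber_poly_inj.
- by rewrite fiber_polyD !fiber_poly_proj fiber_polyD coefD scalerDl.
- by rewrite /= !mulr_algl fiber_polyZ !fiber_poly_proj fiber_polyZ coefCM -!mul_polyC rmorphM
  mulrA.
- by rewrite !fiber_poly_proj coefZ coefXn eqxx mulr1.
Qed.

Lemma fiber_proj_mono j k w : w \in W k ->
  fiber_proj j (fiber_mono k w) = if j == k then fiber_mono k w else 0.
Proof.
move=> wk; apply: fiber_poly_inj; rewrite fiber_poly_proj fiber_poly_mono // coefZ coefXn.
by case: eqP => [->|_]; rewrite ?fiber_poly_mono ?mulr1 // mulr0 scale0r fiber_poly0.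
Qed.

Definition fiber_gens : seq F := [seq fiber_mono 1 w | w <- W 1].

Lemma fiber_standard_graded : standard_graded (in_alg F) fiber_proj fiber_gens.
Proof.
have G := fiber_projections; split=> //.
- move=> k _ x /mapP[w w1 ->]; apply: fiber_poly_inj.
  rewrite fiber_poly_proj !fiber_polyM fiber_poly_mono // fiber_poly_proj -scalerAl coefZ expr1
    coefXM /=.
  by rewrite -[in RHS]scalerAl -scalerAr scalerA exprS.
- move=> _ x /mapP[w w1 ->]; apply: fiber_poly_inj.
  by rewrite fiber_poly_proj fiber_polyM fiber_poly_mono // -scalerAl coefZ expr1 coefXM mulr0
    scale0r fiber_poly0.
move=> k x; pose Q z := exists y : nat -> F,
  z = \sum_(i < size fiber_gens) fiber_gens`_i * fiber_proj k (y i).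
rewrite /fiber_proj big_seq; apply: (big_ind Q) => [|y z [y' ->] [z' ->]|w wk].
- by exists (fun=> 0); rewrite big1 // => i _; rewrite (gr_0 G) mulr0.
- exists (fun i => y' i + z' i); rewrite -big_split; apply: eq_bigr => i _.
  by rewrite (gr_add G) mulrDr.
have /mem_sumsS[u [w' [uv w'k def_w]]] := wk.
have u1 : u \in W 1 by rewrite mem_sums1.
set c := _@_w; exists (fun i => if i == index u (W 1) then c *: fiber_mono k w' else 0).
have iu : (index u (W 1) < size fiber_gens)%N by rewrite size_map index_mem.
rewrite (bigD1 (Ordinal iu)) //= eqxx big1 => [|i]; last first.
  by rewrite -val_eqE /= => /negPf ->; rewrite (gr_0 G) mulr0.
rewrite addr0 (nth_map 0%MM) ?index_mem // nth_index //.
rewrite -[c *: fiber_mono k w']mulr_algl [fiber_proj k _](gr_sigma G k c) fiber_proj_mono // eqxx.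
by rewrite mulrCA fiber_monoM // add1n -def_w mulr_algl.
Qed.

End FiberConeModel.

(** * The Hilbert function of the fiber cone and the generators of powers *)

Section Dimension.
Variables (K : fieldType) (A : comAlgType K).
Local Notation zero_ideal := [set (0 : A)].

Lemma lincomb_in_alg (c : nat -> K) (b : seq A) :
  lincomb (in_alg A) c b = \sum_(i < size b) c i *: b`_i.
Proof. by apply: eq_bigr => i _; rewrite mulr_algl. Qed.

Lemma is_basis_size (V : set A) d d' (v : 'I_d -> A) (v' : 'I_d' -> A) :
  is_basis V v -> is_basis V v' -> (d <= d')%N.
Proof.
move=> [vV vI _] [_ _ v'D].
pose b := [seq v i | i <- enum 'I_d]; pose b' := [seq v' i | i <- enum 'I_d'].
have sb : size b = d by rewrite size_map size_enum_ord.
have sb' : size b' = d' by rewrite size_map size_enum_ord.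
have vE (i : 'I_d) : b`_i = v i by rewrite (nth_map i) ?size_enum_ord // nth_ord_enum.
have v'E (i : 'I_d') : b'`_i = v' i by rewrite (nth_map i) ?size_enum_ord // nth_ord_enum.
rewrite -sb -sb'; apply: (independent_size (zero_ideal_ideal A) (sigma := in_alg A)).
  move=> c; rewrite lincomb_in_alg sb => e i id.
  have := vI (fun i => c i) _ (Ordinal id); apply.
  by rewrite -[RHS]e; apply: eq_bigr => j _; rewrite vE.
move=> _ /mapP[i _ ->]; have [c def_vi] := v'D _ (vV i).
exists 1; first exact: oner_neq0.
exists (fun j => if insub j is Some j then c j else 0).
rewrite lincomb_in_alg sb' /= scale1r mul1r def_vi; apply/eqP; rewrite subr_eq0; apply/eqP.
by apply: eq_bigr => j _; rewrite v'E valK.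
Qed.

Lemma dim_of_eq (V : set A) d (v : 'I_d -> A) : is_basis V v -> dim_of V = d.
Proof.
move=> vB; rewrite /dim_of; case: xgetP => [e _ [w wB]|/(_ d)]; last by case; exists v.
by apply/eqP; rewrite eqn_leq (is_basis_size wB vB) (is_basis_size vB wB).
Qed.

End Dimension.

Section FiberConeInvariants.
Variables (K : fieldType) (n : nat) (v : seq 'X_{1..n}) (d : nat).
Hypothesis vd : forall m, m \in v -> mdeg m = d.
Local Notation S := {mpoly K[n]}.
Variable I : set S.
Hypothesis defI : I = ideal_gen [set ('X_[m] : S) | m in [set` v]].
Local Notation W := (sums v).
Local Notation F := (fiber_cone I).
Local Notation fiber_mono := (@fiber_mono K n d I).
Local Notation fiber_poly := (@fiber_poly K n d I).
Local Notation proj := (@fiber_proj K n v d I).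

Definition fiber_monos k : seq F := map (fiber_mono k) (W k).

Lemma mcoeff_fiber_poly_sum k (c : nat -> K) i : (i < size (W k))%N ->
  ((fiber_poly (\sum_(j < size (W k)) c j *: fiber_mono k (nth 0%MM (W k) j)))`_k)
    @_(nth 0%MM (W k) i) = c i.
Proof.
move=> ik; rewrite (fiber_poly_sum vd defI) coef_sum raddf_sum (bigD1 (Ordinal ik)) //=.
rewrite big1 => [|j]; last first.
  rewrite -val_eqE /= => ji; rewrite (fiber_polyZ vd defI) (fiber_poly_mono vd defI) ?mem_nth //.
  rewrite coefCM coefZ coefXn eqxx mulr1 mul_mpolyC mcoeffZ mcoeffX.
  by rewrite nth_uniq ?sums_uniq // (negPf ji) mulr0.
rewrite (fiber_polyZ vd defI) (fiber_poly_mono vd defI) ?mem_nth //.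
by rewrite coefCM coefZ coefXn eqxx mulr1 mul_mpolyC mcoeffZ mcoeffX eqxx mulr1 addr0.
Qed.

Lemma fiber_projE k x : proj k x =
  \sum_(j < size (W k))
    ((fiber_poly x)`_k)@_(nth 0%MM (W k) j) *: fiber_mono k (nth 0%MM (W k) j).
Proof. by rewrite /fiber_proj (big_nth 0%MM) big_mkord. Qed.

Lemma fiber_monos_basis k :
  is_basis (fiber_grading I k) (fun i : 'I_(size (W k)) => fiber_mono k (nth 0%MM (W k) i)).
Proof.
split.
- move=> i; apply/(fiber_grading_proj vd defI).
  by rewrite (fiber_proj_mono vd defI) ?mem_nth // eqxx.
- move=> c c0 i; pose c' j := if insub j is Some j then c j else 0.
  have := @mcoeff_fiber_poly_sum k c' i (ltn_ord i).
  have -> : \sum_(j < size (W k)) c' j *: fiber_mono k (nth 0%MM (W k) j) = 0.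
    by rewrite -[RHS]c0; apply: eq_bigr => j _; rewrite /c' valK.
  by rewrite (fiber_poly0 vd defI) coef0 mcoeff0 /c' valK.
move=> x /(fiber_grading_proj vd defI) <-; rewrite fiber_projE.
by exists (fun j => ((fiber_poly x)`_k)@_(nth 0%MM (W k) j)).
Qed.

Lemma hilbert_function_fiber k : hilbert_function (fiber_grading I) k = size (W k).
Proof. exact: dim_of_eq (fiber_monos_basis k). Qed.

Lemma nth_fiber_monos k i : (i < size (W k))%N ->
  (fiber_monos k)`_i = fiber_mono k (nth 0%MM (W k) i).
Proof. by move=> ik; rewrite (nth_map 0%MM). Qed.

Lemma lincomb_fiber_monos k c : lincomb (in_alg F) c (fiber_monos k) =
  \sum_(j < size (W k)) c j *: fiber_mono k (nth 0%MM (W k) j).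
Proof.
rewrite lincomb_in_alg size_map; apply: eq_bigr => i _.
by rewrite nth_fiber_monos.
Qed.

Lemma fiber_proj_depends k x : depends (in_alg F) [set 0] (fiber_monos k) (proj k x).
Proof.
exists 1; first exact: oner_neq0.
exists (fun j => ((fiber_poly x)`_k)@_(nth 0%MM (W k) j)).
by rewrite lincomb_fiber_monos -fiber_projE /= scale1r mul1r subrr.
Qed.

Lemma fiber_has_rank k :
  has_rank (in_alg F) [set 0] (component proj k) (size (W k)).
Proof.
exists (fiber_monos k); split; first exact: size_map.
- move=> _ /mapP[w wk ->].
  by rewrite /component /= (fiber_proj_mono vd defI) // eqxx.
- move=> c c0 i; rewrite size_map => ik.
  have := @mcoeff_fiber_poly_sum k c i ik; rewrite -lincomb_fiber_monos c0.
  by rewrite (fiber_poly0 vd defI) coef0 mcoeff0.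
by move=> x <-; exact: fiber_proj_depends.
Qed.

Lemma irrelevant_gens :
  irrelevant_ideal (fiber_grading I) `<=` ideal_gen [set` fiber_gens v d I].
Proof.
have II := ideal_gen_ideal [set` fiber_gens v d I].
apply: ideal_gen_min => // x [[//|k] _ /(fiber_grading_proj vd defI) <-].
have [y ->] := gr_span (fiber_standard_graded vd defI) k x.
apply: ideal_sum => // i _; rewrite mulrC; apply: idealMl => //.
by apply: ideal_gen_sub; exact: mem_nth.
Qed.

Lemma fiber_monos_one : 1 \in fiber_monos 0.
Proof. by rewrite inE -(fiber_mono1 vd defI) eqxx. Qed.

Lemma fiber_monos_mul i j x y : x \in fiber_monos i -> y \in fiber_monos j ->
  x * y \in fiber_monos (i + j)%N.
Proof.
move=> /mapP[u ui ->] /mapP[w wj ->].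
by rewrite (fiber_monoM vd defI) //; apply: map_f; exact: sumsD.
Qed.

Lemma fiber_monos_span x :
  exists k, depends (in_alg F) [set 0] (flatten [seq fiber_monos i | i <- iota 0 k]) x.
Proof.
exists (size (fiber_poly x)); rewrite {2}[x](fiber_proj_sum vd defI).
have Z0 := zero_ideal_ideal F.
apply: (big_ind (depends (in_alg F) [set 0] _)) => [||i _].
- exact: depends_ideal.
- by move=> y z; exact: dependsD.
apply: depends_trans (fiber_proj_depends i x) => // y yi; apply: depends_mem => //.
by apply/flatten_mapP; exists (i : nat); rewrite ?mem_iota ?ltn_ord.
Qed.

Lemma deg_part0C (p : S) : deg_part 0 p = (p@_0%MM)%:MP.
Proof.
apply/mpolyP => m; rewrite mcoeff_deg_part mcoeffC mdeg_eq0.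
by case: eqP => [->|_]; rewrite ?mulr1 ?mulr0.
Qed.

(** Graded Nakayama: the lowest components of any generators of [I^k] span
    its lowest component. *)
Lemma num_gen_power k : num_gen (ideal_exp I k) = size (W k).
Proof.
apply: nat_min_eq.
  exists [seq 'X_[w] | w <- W k]; first exact: size_map.
  rewrite (ideal_exp_monideal defI) -ideal_gen_monomials; congr ideal_gen.
  apply/seteqP; split=> p /=; first by move=> [w wk <-]; exact: map_f.
  by move=> /mapP[w wk ->]; exists w.
move=> _ [s <- defIk].
rewrite -(size_map (deg_part (k * d)) s) -(size_map (fun w => 'X_[w] : S) (W k)).
have Z0 := zero_ideal_ideal S.
apply: (independent_size Z0 (sigma := in_alg S)) => [c|p].
  rewrite lincomb_in_alg size_map /= => c0 i ik.
  have := congr1 (mcoeff (nth 0%MM (W k) i)) c0.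
  rewrite mcoeff0 raddf_sum (bigD1 (Ordinal ik)) //= big1 => [|j].
    by rewrite addr0 mcoeffZ (nth_map 0%MM) // mcoeffX eqxx mulr1.
  rewrite -val_eqE /= => ji; rewrite mcoeffZ (nth_map 0%MM) // mcoeffX.
  by rewrite nth_uniq ?sums_uniq // (negPf ji) mulr0.
move=> /mapP[w wk ->].
have : ideal_exp I k 'X_[w].
  rewrite (ideal_exp_monideal defI) => m; rewrite msuppX inE => /eqP ->.
  by exists w => //; exact: lepm_refl.
rewrite defIk => -[t ts Xw].
have Xh : ('X_[w] : S) \is (k * d).-homog by rewrite dhomogX /= (mdeg_sums vd wk).
rewrite -(deg_part_homog Xh) Xw deg_part_sum big_seq.
apply: (big_ind (depends (in_alg S) [set 0] _)) => [||u ut].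
- exact: depends_ideal.
- by move=> y z; exact: dependsD.
(* In degree [k * d] only the constant term of the coefficient [u.1] counts. *)
rewrite -[(k * d)%N]add0n deg_partM; last first.
- apply: (monideal_order vd); rewrite -(ideal_exp_monideal defI) defIk.
  by apply: ideal_gen_sub; exact: ts.
- by move=> m _.
rewrite deg_part0C mul_mpolyC -mulr_algl; apply: dependsZ => //.
by apply: depends_mem => //; apply: map_f; exact: ts.
Qed.

End FiberConeInvariants.

(** * The Krull dimension of the fiber cone *)

(** Equal members of an increasing sequence of primes are skipped; the bound
    counts the strict inclusions. *)
Lemma prime_chain_extract (R : comNzRingType) N (P : nat -> set R) :
  (forall i, (i <= N)%N -> is_prime_ideal (P i)) ->
  (forall i, (i < N)%N -> P i `<=` P i.+1) ->
  exists Q, @prime_chain R (\sum_(i < N) `[< ~ P i.+1 `<=` P i >]) Q.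
Proof.
move=> Pp Ps.
suff [Q [Qc _]] : exists Q, @prime_chain R (\sum_(i < N) `[< ~ P i.+1 `<=` P i >]) Q /\
    Q (\sum_(i < N) `[< ~ P i.+1 `<=` P i >])%N = P N by exists Q.
elim: N Pp Ps => [|N IHN] Pp Ps.
  by exists P; rewrite big_ord0; split=> //; split=> // i; rewrite leqn0 => /eqP ->; exact: Pp.
have [|i iN|Q [[Qp Qs] QN]] := IHN.
- by move=> i iN; apply: Pp; exact: leqW.
- by apply: Ps; exact: ltnW.
rewrite big_ord_recr /=; move: QN Qp Qs; set r := (\sum_(i < N) _)%N => QN Qp Qs.
have [PN|PN] := pselect (P N.+1 `<=` P N).
  have -> : `[< ~ P N.+1 `<=` P N >] = false by apply/asboolP => /(_ PN).
  rewrite addn0; exists Q; split=> //; rewrite QN; apply/seteqP; split=> //.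
  exact: Ps.
have -> : `[< ~ P N.+1 `<=` P N >] by apply/asboolP.
rewrite addn1; exists (fun i => if (i <= r)%N then Q i else P N.+1); split; last by rewrite ltnn.
split=> i.
  by move=> _; case: (leqP i r) => [ir|_]; [exact: Qp | exact: Pp].
rewrite ltnS => ir; rewrite ir; case: (ltnP i r) => [|ri]; first exact: Qs.
have -> : i = r by apply/eqP; rewrite eqn_leq ir.
by rewrite QN; split=> //; exact: Ps.
Qed.

Section Specialization.
Variables (K : fieldType) (n : nat).
Local Notation S := {mpoly K[n]}.

Definition drop_mon j (m : 'X_{1..n}) : 'X_{1..n} :=
  [multinom (if (i < j)%N then 0%N else m i) | i < n].

Definition subst_one j (p : S) : S :=
  mmap (@mpolyC n K) (fun i : 'I_n => if (i < j)%N then 1 else 'X_i) p.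

HB.instance Definition _ j := GRing.RMorphism.copy (subst_one j) (subst_one j).

Lemma subst_oneX j m : subst_one j 'X_[m] = 'X_[drop_mon j m].
Proof.
rewrite /subst_one mmapX /mmap1 (mpolyXE_id _ (drop_mon j m)).
apply: eq_bigr => i _; rewrite mnmE; case: ifP => _; first by rewrite expr1n expr0.
by [].
Qed.

Lemma subst_oneZ j c p : subst_one j (c *: p) = c *: subst_one j p.
Proof. by rewrite /subst_one mmapZ mul_mpolyC. Qed.

Lemma drop_monK j l m : (j <= l)%N -> drop_mon l (drop_mon j m) = drop_mon l m.
Proof.
move=> jl; apply/mnmP => i; rewrite !mnmE; case: ltnP => // li.
by rewrite ltnNge (leq_trans jl li).
Qed.

Lemma subst_oneK j l p : (j <= l)%N -> subst_one l (subst_one j p) = subst_one l p.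
Proof.
move=> jl; rewrite [p]mpolyE.
rewrite (raddf_sum (subst_one j)) (raddf_sum (subst_one l)) [RHS](raddf_sum (subst_one l)).
apply: eq_bigr => m _.
by rewrite /= !subst_oneZ !subst_oneX drop_monK.
Qed.

(** Sets the first [j] of the variables [X_0, ..., X_(n-1), 'X] equal to 1. *)
Definition specialize j (p : {poly S}) : {poly S} :=
  map_poly (subst_one j) p \Po (if (j <= n)%N then 'X else 1).

Lemma specializeD j : {morph specialize j : p q / p + q}.
Proof. by move=> p q; rewrite /specialize rmorphD raddfD. Qed.

Lemma specializeM j : {morph specialize j : p q / p * q}.
Proof. by move=> p q; rewrite /specialize !rmorphM. Qed.

Lemma specialize0 j : specialize j 0 = 0.
Proof. by rewrite /specialize !rmorph0. Qed.

Lemma specializeB j : {morph specialize j : p q / p - q}.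
Proof. by move=> p q; rewrite /specialize rmorphB raddfB. Qed.

Lemma specialize1 j : specialize j 1 = 1.
Proof. by rewrite /specialize !rmorph1. Qed.

Lemma specialize_next j p : (j <= n)%N ->
  specialize j.+1 (specialize j p) = specialize j.+1 p.
Proof.
move=> jn; rewrite /specialize jn comp_polyXr; congr (_ \Po _).
by apply/polyP => i; rewrite !coef_map /= subst_oneK.
Qed.

(** A pair [(k, m)] stands for the monomial [X_[m] 'X^k]; its variables are
    numbered from 0 to [n], the last one being ['X]. *)
Definition special_exponent j (km : nat * 'X_{1..n}) : nat * 'X_{1..n} :=
  ((if (j <= n)%N then km.1 else 0%N), drop_mon j km.2).

Definition coordinate j (km : nat * 'X_{1..n}) : nat :=
  if insub j is Some i then km.2 i else km.1.

Lemma specialize_mono j k m :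
  specialize j ('X_[m] *: 'X^k) =
    'X_[(special_exponent j (k, m)).2] *: 'X^((special_exponent j (k, m)).1).
Proof.
rewrite /specialize /special_exponent map_polyZ map_polyXn /= subst_oneX; case: ifP => _.
  by rewrite comp_polyXr.
by rewrite linearZ /= rmorphXn /= comp_polyX expr1n expr0.
Qed.

Lemma mono_inj (km lm : nat * 'X_{1..n}) :
  'X_[km.2] *: 'X^(km.1) = 'X_[lm.2] *: 'X^(lm.1) :> {poly S} -> km = lm.
Proof.
case: km lm => [k m] [l m'] /= e.
have := congr1 (fun p : {poly S} => (p`_k)@_m) e.
rewrite !coefZ !coefXn eqxx mulr1 mcoeffX eqxx.
case: eqP => [<-|_]; last by rewrite mulr0 mcoeff0 => /eqP; rewrite oner_eq0.
rewrite mulr1 mcoeffX; case: eqP => [->//|_ /eqP]; by rewrite oner_eq0.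
Qed.

Lemma special_exponent0 km : special_exponent 0 km = km.
Proof. by case: km => k m; congr pair; apply/mnmP => i; rewrite mnmE. Qed.

Lemma special_exponent_last km : special_exponent n.+1 km = (0%N, 0%MM).
Proof.
rewrite /special_exponent ltnn; congr pair; apply/mnmP => i; rewrite !mnmE.
by rewrite ltnS ltnW.
Qed.

Lemma special_exponent_next j km lm : (j <= n)%N -> coordinate j km = coordinate j lm ->
  special_exponent j.+1 km = special_exponent j.+1 lm ->
  special_exponent j km = special_exponent j lm.
Proof.
move=> jn jkl e; have ke := congr1 fst e.
have de (l : 'I_n) : drop_mon j.+1 km.2 l = drop_mon j.+1 lm.2 l.
  exact: (congr1 (fun x : nat * 'X_{1..n} => x.2 l) e).
move: jkl ke; rewrite /special_exponent /coordinate /= jn.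
case: insubP => [i ltjn def_i jkl|nj jkl _].
  rewrite ltjn => ->; congr pair; apply/mnmP => l; rewrite !mnmE.
  case: ltnP => // jl; move: (de l); rewrite !mnmE ltnS.
  have [lj _|ne] := eqVneq (l : nat) j.
    by have -> : l = i by apply: val_inj; rewrite def_i.
  by rewrite leqNgt ltn_neqAle eq_sym ne jl.
rewrite jkl; congr pair; apply/mnmP => l; rewrite !mnmE.
by rewrite (leq_trans (ltn_ord l)) // leqNgt.
Qed.

End Specialization.

Section FiberConeDimension.
Variables (K : fieldType) (n : nat) (v : seq 'X_{1..n}) (d : nat).
Hypothesis vd : forall m, m \in v -> mdeg m = d.
Local Notation S := {mpoly K[n]}.
Variable I : set S.
Hypothesis defI : I = ideal_gen [set ('X_[m] : S) | m in [set` v]].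
Local Notation W := (sums v).
Local Notation F := (fiber_cone I).
Local Notation fiber_mono := (@fiber_mono K n d I).
Local Notation fiber_poly := (@fiber_poly K n d I).

Definition special_prime j : set F := [set x | specialize j (fiber_poly x) = 0].

Lemma special_prime_prime j : is_prime_ideal (special_prime j).
Proof.
rewrite /special_prime; split; first split.
- by rewrite /= (fiber_poly0 vd defI) specialize0.
- by move=> a b /= pa pb; rewrite (fiber_polyD vd defI) specializeD pa pb addr0.
- by move=> r a /= pa; rewrite (fiber_polyM vd defI) specializeM pa mulr0.
- by rewrite /= (fiber_poly1 vd defI) specialize1 => /eqP; rewrite oner_eq0.
move=> a b /=; rewrite (fiber_polyM vd defI) specializeM => /eqP; rewrite mulf_eq0.
by case/orP => /eqP; [left|right].
Qed.

Lemma special_prime_sub j : (j < n.+1)%N -> special_prime j `<=` special_prime j.+1.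
Proof.
by rewrite ltnS => jn x; rewrite /special_prime /= -(specialize_next _ jn) => ->;
  rewrite specialize0.
Qed.

Definition strict_step j : bool := `[< ~ special_prime j.+1 `<=` special_prime j >].

(** The rank of the group generated by the exponents [(k, w)] of the monomials
    of the fiber cone. *)
Definition monomial_rank : nat := \sum_(j < n.+1) strict_step j.

(** Where [special_prime j = special_prime j.+1], setting the [j]-th variable
    equal to 1 identifies no monomials, so the other coordinates determine that
    one. *)
Lemma strict_coordinates km lm : km.2 \in W km.1 -> lm.2 \in W lm.1 ->
  (forall j, (j < n.+1)%N -> strict_step j -> coordinate j km = coordinate j lm) ->
  km = lm.
Proof.
case: km lm => [k m] [l m'] /= mk ml same.
suff eqk t : (t <= n.+1)%N ->
    special_exponent (n.+1 - t) (k, m) = special_exponent (n.+1 - t) (l, m').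
  by have := eqk n.+1 (leqnn _); rewrite subnn !special_exponent0.
elim: t => [|t IHt] lt; first by rewrite subn0 !special_exponent_last.
have jn : (n.+1 - t.+1 <= n)%N by rewrite subSS leq_subr.
have := IHt (ltnW lt); rewrite -(subnSK lt); move: (n.+1 - t.+1)%N jn => j jn eqj.
have [js|/asboolPn/contrapT jNs] := boolP (strict_step j).
  by apply: special_exponent_next => //; exact: same.
have : special_prime j (fiber_mono k m - fiber_mono l m').
  apply: jNs; rewrite /special_prime /= (fiber_polyB vd defI) specializeB !(fiber_poly_mono vd
    defI) //.
  by rewrite !specialize_mono eqj subrr.
rewrite /special_prime /= (fiber_polyB vd defI) specializeB !(fiber_poly_mono vd defI) //.
rewrite !specialize_mono => /eqP; rewrite subr_eq0 => /eqP.
exact: (@mono_inj K n (special_exponent j (k, m)) (special_exponent j (l, m'))).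
Qed.

(** By [strict_coordinates], a monomial of degree at most [k] is determined by
    [monomial_rank] of its coordinates. Each is at most [d k] or [k]. *)
Lemma size_filtration k :
  (size (filtration (fiber_monos v d I) k) <= d.+1 ^ monomial_rank * k.+1 ^ monomial_rank)%N.
Proof.
pose L := [seq (i, w) | i <- iota 0 k.+1, w <- W i].
have -> : size (filtration (fiber_monos v d I) k) = size L.
  rewrite /filtration size_flatten /shape -map_comp size_allpairs_dep.
  by congr sumn; apply: eq_map => i /=; rewrite size_map.
have LP km : km \in L -> (km.1 <= k)%N /\ km.2 \in W km.1.
  by move=> /allpairsPdep[i [w [+ wi ->]]]; rewrite mem_iota ltnS.
have Luniq : uniq L.
  apply: allpairs_uniq_dep; first exact: iota_uniq.
    by move=> i _; exact: sums_uniq.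
  by move=> [i w] [i' w'] _ _ /= [-> ->].
pose T := {j : 'I_n.+1 | strict_step j}.
pose M := (d.+1 * k.+1).-1.
have M1 : M.+1 = (d.+1 * k.+1)%N by rewrite prednK.
pose code (km : nat * 'X_{1..n}) : {ffun T -> 'I_M.+1} :=
  [ffun j => inord (coordinate (val (val j)) km)].
have bound a b : (a <= k -> b <= a * d -> b < d.+1 * k.+1)%N by nia.
have coordM j km : km \in L -> (coordinate j km < M.+1)%N.
  move=> /LP[ik wi]; rewrite M1 /coordinate; case: insubP => [i _ _|_].
    2: by apply: leq_ltn_trans ik _; rewrite mulSn leq_addr.
  have : (km.2 i <= mdeg km.2)%N by rewrite mdegE (bigD1 i) //= leq_addr.
  by rewrite (mdeg_sums vd wi); exact: bound.
have code_inj : {in L &, injective code}.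
  move=> km lm kmL lmL /ffunP e; have [_ kmW] := LP _ kmL; have [_ lmW] := LP _ lmL.
  apply: strict_coordinates => // j jn js.
  have := e (exist _ (Ordinal jn) js : T); rewrite !ffunE /= => /(congr1 (@nat_of_ord _)).
  by rewrite !inordK ?coordM.
rewrite -(size_map code) -expnMn -M1.
have -> : monomial_rank = #|{: T}|.
  by rewrite card_sig /monomial_rank -sum1_card [RHS]big_mkcond; apply: eq_bigr => j _;
    rewrite inE; case: strict_step.
have <- : #|{: {ffun T -> 'I_M.+1}}| = (M.+1 ^ #|{: T}|)%N by rewrite card_ffun card_ord.
have /card_uniqP <- : uniq (map code L) by rewrite (map_inj_in_uniq code_inj).
exact: max_card.
Qed.

Lemma fiber_prime_chain : exists Q : nat -> set F, prime_chain monomial_rank Q.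
Proof.
exact: (prime_chain_extract (fun j _ => special_prime_prime j) special_prime_sub).
Qed.

Lemma krull_dim_fiber : krull_dim F = monomial_rank.
Proof.
have [Q Qc] := fiber_prime_chain.
exact: (krull_dim_growth (fiber_monos_one vd defI) (fiber_monos_mul vd defI) (fiber_monos_span
  vd defI)
  size_filtration Qc).
Qed.

End FiberConeDimension.

(** * Quadric hypersurfaces *)

Definition shift2 (f : nat -> nat) k := if k is k'.+2 then f k' else 0%N.

Lemma psum_add r f g k : psum r (fun i => f i + g i)%N k = (psum r f k + psum r g k)%N.
Proof. by elim: r k => //= r IHr k; rewrite -big_split; apply: eq_bigr. Qed.

Lemma psum_shift2 r f k : psum r (shift2 f) k = shift2 (psum r f) k.
Proof.
elim: r k => // r IHr k /=; rewrite (eq_bigr (fun i : 'I__ => shift2 (psum r f) i)) => [|i _].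
  case: k => [|[|k]]; first by rewrite big_ord1.
    by rewrite 2!big_ord_recl big_ord0.
  by rewrite 2!big_ord_recl.
exact: IHr.
Qed.

(** The numerator [1 + t] of the Hilbert series of a quadric hypersurface. *)
Definition quadric_h i : nat := (i < 2)%N.

(** (1 - t^2) / (1 - t)^(r + 1) = (1 + t) / (1 - t)^r. *)
Lemma psum_quadric r k :
  'C(k + r, r) = (psum r quadric_h k + shift2 (fun j => 'C(j + r, r)) k)%N.
Proof.
rewrite -psum_delta -psum_swap.
have e i : psum 1 (fun i => (i == 0)%N : nat) i = 1%N.
  by rewrite /= big_ord_recl /= big1.
rewrite (@eq_psum _ _ (fun i => quadric_h i + shift2 (fun=> 1) i)%N) => [|i _]; last first.
  by rewrite e; case: i => [|[|i]].
rewrite psum_add psum_shift2; congr (_ + _)%N.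
case: k => [|[|k]] //=; rewrite -psum_delta -psum_swap.
by apply: eq_psum => i _; rewrite e.
Qed.

Section QuadricHilbert.
Variables (K : fieldType) (n : nat) (q : quadric K n.+1).
Local Notation T := {mpoly K[n.+1]}.
Local Notation g := (quadric_poly q).
Local Notation Z0 := (zero_ideal_ideal T).

Lemma deg_part_projections : grading_projections (in_alg T) (fun k : nat => @deg_part K n.+1 k).
Proof.
split=> [k p p'|k c p|k p]; first exact: deg_partD.
  by rewrite /= !mulr_algl; apply/mpolyP => m;
    rewrite mcoeff_deg_part !mcoeffZ mcoeff_deg_part; case: eqP; rewrite ?mulr0.
by apply/mpolyP => m; rewrite !mcoeff_deg_part; case: eqP.
Qed.

Lemma homogeneous_mul_homog e (p : T) : p \is e.-homog ->
  homogeneous_mul (fun k : nat => @deg_part K n.+1 k) e p.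
Proof.
move=> pe; have G := deg_part_projections.
have X k m : deg_part k (p * 'X_[m]) = if k == (e + mdeg m)%N then p * 'X_[m] else 0.
  have pm : p * 'X_[m] \is (e + mdeg m)%N.-homog.
    by apply: dhomogM => //; rewrite dhomogX.
  case: eqP => [->|ne]; first exact: deg_part_homog.
  by rewrite /deg_part (pihomog_ne0 _ pm) // eq_sym; apply/eqP.
have XZ k m c : deg_part k (p * (c *: 'X_[m])) = c *: deg_part k (p * 'X_[m]).
  by rewrite -scalerAr /deg_part linearZ.
split=> k x.
  rewrite [x]mpolyE mulr_sumr !deg_part_sum mulr_sumr; apply: eq_bigr => m _.
  rewrite XZ X /deg_part linearZ /= pihomogX addnC eqn_add2l eq_sym.
  by case: ifP => _; [rewrite scalerAr | rewrite !scaler0 mulr0].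
move=> ke; rewrite [x]mpolyE mulr_sumr deg_part_sum big1 // => m _.
by rewrite XZ X ltn_eqF ?scaler0 // ltn_addr.
Qed.

Definition monomials k : seq 'X_{1..n.+1} :=
  [seq s2m t | t : k.-tuple 'I_n.+1 <- enum (basis n.+1 k)].

Lemma polynomials_rank k :
  has_rank (in_alg T) [set 0] (component (fun k : nat => @deg_part K n.+1 k) k) 'C(k + n, n).
Proof.
have memM m : (m \in monomials k) = (mdeg m == k) by rewrite -basis_cover.
exists [seq 'X_[m] | m <- monomials k]; split.
- by rewrite size_map size_basis -bin_sub ?leq_addr // addKn.
- move=> _ /mapP[m mk ->]; apply: deg_part_homog.
  by rewrite dhomogX /= -memM.
- move=> c; rewrite lincomb_in_alg size_map /= => c0 i ik.
  have := congr1 (mcoeff (nth 0%MM (monomials k) i)) c0.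
  rewrite mcoeff0 raddf_sum (bigD1 (Ordinal ik)) //= big1 => [|j].
    by rewrite addr0 mcoeffZ (nth_map 0%MM) // mcoeffX eqxx mulr1.
  rewrite -val_eqE /= => ji; rewrite mcoeffZ (nth_map 0%MM) // mcoeffX.
  by rewrite nth_uniq ?uniq_basis // (negPf ji) mulr0.
move=> x; rewrite /component /= => <-; rewrite /deg_part pihomogE.
rewrite big_seq_cond; apply: (big_ind (depends (in_alg T) [set 0] _)) => [||m /andP[_ mk]].
- exact: depends_ideal.
- by move=> y z; exact: (dependsD Z0).
rewrite -mulr_algl; apply: (dependsZ Z0); apply: (depends_mem _ Z0).
by apply: map_f; rewrite memM.
Qed.

(** The quadric is regular on the polynomial ring, whose Hilbert function is
    C(k + n, n). *)
Lemma quadric_rank k : has_rank (in_alg T) (ideal_add [set 0] g)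
  (component (fun k : nat => @deg_part K n.+1 k) k) (psum n quadric_h k).
Proof.
have G := deg_part_projections; have gH := homogeneous_mul_homog (quadric_homog q).
have H0 : homogeneous_ideal (fun k : nat => @deg_part K n.+1 k) [set (0 : T)].
  by move=> x j -> /=; rewrite deg_part0.
have gR : regular_mod [set (0 : T)] g.
  by move=> x /= /eqP; rewrite mulf_eq0 (negPf (quadric_neq0 q)) => /eqP.
have Tk := polynomials_rank k; rewrite psum_quadric in Tk.
case: k Tk => [|[|k]] Tk.
- by rewrite -[X in has_rank _ _ _ X]addn0; exact: (has_rank_low G H0 gH _ Tk).
- by rewrite -[X in has_rank _ _ _ X]addn0; exact: (has_rank_low G H0 gH _ Tk).
have [h hP] := exists_rank_add g Z0 Tk.
have Tk0 := polynomials_rank k.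
have : has_rank (in_alg T) [set 0] (component (fun k : nat => @deg_part K n.+1 k) (k + 2))
    ('C(k + n, n) + h).
  by apply: (has_rank_exact G Z0 H0 gH gR) => //; rewrite addn2.
rewrite addn2 => /(has_rank_uniq Z0 Tk); rewrite addnC => /addnI eh.
by rewrite eh.
Qed.

Local Notation piQ := (\pi_({ideal_quot (quadric_ideal q)})).

Lemma quadric_ring_eq0 p : (piQ p : quadric_ring q) = 0 <-> ideal_add [set 0] g p.
Proof.
have -> : ((piQ p : quadric_ring q) = 0) <-> (p \in quadric_ideal q).
  have := Quotient.idealrBE (quadric_ideal q) p 0; rewrite subr0 => ->.
  rewrite -(rmorph0 piQ); split=> [->|/eqP //]; exact: eqxx.
have -> : (p \in quadric_ideal q) <-> ideal_gen [set g] p by split=> /asboolP.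
split; first apply: ideal_gen_min => [|_ ->].
- exact: (ideal_add_ideal _ Z0).
- by rewrite -[X in ideal_add _ _ X]mulr1; exact: (ideal_add_mul _ _ Z0).
move=> [_ [z [-> ->]]]; rewrite add0r mulrC; apply: idealMl; first exact: ideal_gen_ideal.
exact: ideal_gen_sub.
Qed.

Lemma hilbert_function_quadric k :
  exists w : 'I_(psum n quadric_h k) -> quadric_ring q, is_basis (quadric_grading q k) w.
Proof.
have [b [sb bV bI bD]] := quadric_rank k.
have piS c (p : T) : c *: (piQ p : quadric_ring q) = piQ (c *: p) by exact: alg_quot_scale_pi.
have piL (c : nat -> K) : \sum_(i < psum n quadric_h k) c i *: (piQ b`_i : quadric_ring q) =
    piQ (lincomb (in_alg T) c b).
  by rewrite lincomb_in_alg sb rmorph_sum; apply: eq_bigr => i _; rewrite piS.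
exists (fun i => piQ b`_i); split.
- move=> i; exists b`_i => //; rewrite /mpoly_grading /= homog_piE; apply/eqP.
  by apply: bV; apply: mem_nth; rewrite sb.
- move=> c c0 i; pose c' j := if insub j is Some j then c j else 0.
  have <- : c' i = c i by rewrite /c' valK.
  apply: bI; last by rewrite sb.
  apply/quadric_ring_eq0; rewrite -piL -[RHS]c0; apply: eq_bigr => j _.
  by rewrite /c' valK.
move=> _ [p pk <-]; have [|s s0 [c pc]] := bD p.
  by move: pk; rewrite /mpoly_grading /= homog_piE => /eqP.
exists (fun i => s^-1 * c i).
have /quadric_ring_eq0 := pc; rewrite /= mulr_algl.
move=> e0; have : (piQ (s *: p) : quadric_ring q) = piQ (lincomb (in_alg T) c b).
  by apply/eqP; rewrite -subr_eq0 -rmorphB; apply/eqP.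
rewrite -piS -piL => /(congr1 ( *:%R s^-1)); rewrite scalerA mulVf // scale1r => ->.
by rewrite scaler_sumr; apply: eq_bigr => i _; rewrite scalerA.
Qed.

End QuadricHilbert.

Lemma quadric_ord0 (K : fieldType) (q : quadric K 0) : False.
Proof.
have := quadric_neq0 q; rewrite -msupp_eq0; have /dhomogP := quadric_homog q.
case: (msupp _) => //= m s /(_ m); rewrite mem_head => /(_ isT).
by rewrite /= mdegE big_ord0.
Qed.

Lemma graded_iso_basis (K : fieldType) (A B : comAlgType K) (G : nat -> set A)
    (H : nat -> set B) k h (w : 'I_h -> B) :
  graded_iso G H -> is_basis (H k) w -> hilbert_function G k = h.
Proof.
move=> [f [[f' fK f'K] fGH]] [wH wI wD].
apply: (@dim_of_eq _ _ _ _ (f' \o w)); split=> [i|c c0 i|x Gx].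
- by apply/fGH; rewrite /= f'K.
- apply: wI; rewrite -[RHS](rmorph0 f) -c0 rmorph_sum; apply: eq_bigr => j _.
  by rewrite /= linearZ /= f'K.
have [c e] := wD _ ((fGH k x).1 Gx); exists c; rewrite -[x]fK e.
apply: (can_inj fK); rewrite f'K rmorph_sum; apply: eq_bigr => j _.
by rewrite /= linearZ /= f'K.
Qed.

(** * Freiman ideals and minimal multiplicity *)

Lemma psum_at0 r c : psum r c 0 = c 0%N.
Proof. by elim: r => //= r IHr; rewrite big_ord1. Qed.

Lemma psum_at1 r c : psum r c 1 = (c 1 + r * c 0)%N.
Proof.
elim: r => [|r IHr]; first by rewrite addn0.
by rewrite psumS IHr psum_at0 mulSn; lia.
Qed.

Lemma psum_at2 r c : psum r c 2 = (c 2 + r * c 1 + 'C(r.+1, 2) * c 0)%N.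
Proof.
elim: r => [|r IHr]; first by rewrite /= !addn0.
by rewrite psumS IHr psum_at1 [in RHS]binS bin1; nia.
Qed.

Lemma ideal_exp1 (R : comNzRingType) (I : set R) : is_ideal I -> ideal_exp I 1 = I.
Proof.
move=> II; apply/seteqP; split.
  by apply: ideal_gen_min => // _ [a [b [Ia _ ->]]]; rewrite mulrC; exact: idealMl.
by move=> x Ix; apply: ideal_gen_sub; exists x, 1; rewrite mulr1.
Qed.

Lemma ideal_gen_nil (R : comNzRingType) : ideal_gen [set` Nil R] = [set 0].
Proof.
apply/seteqP; split; first by apply: ideal_gen_min => //; exact: zero_ideal_ideal.
by move=> _ ->; case: (ideal_gen_ideal [set` Nil R]).
Qed.

Section Main.
Variables (K : fieldType) (n : nat) (v : seq 'X_{1..n}) (d : nat).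
Hypothesis vd : forall m, m \in v -> mdeg m = d.
Local Notation S := {mpoly K[n]}.
Variable I : set S.
Hypothesis defI : I = ideal_gen [set ('X_[m] : S) | m in [set` v]].
Local Notation W := (sums v).
Local Notation F := (fiber_cone I).
Local Notation r := (monomial_rank d I).
Local Notation h := (fun k => size (W k)).

Lemma size_filtration_psum k : size (filtration (fiber_monos v d I) k) = psum 1 h k.
Proof.
rewrite /filtration size_flatten /shape -map_comp sumnE big_map /= -(big_mkord xpredT h).
by rewrite /index_iota subn0; apply: eq_bigr => i _; rewrite /= size_map.
Qed.

Lemma hilbert_growth k : (psum 1 h k <= d.+1 ^ r * k.+1 ^ r)%N.
Proof. by rewrite -size_filtration_psum; exact: size_filtration. Qed.

Lemma num_gen1 : num_gen I = h 1%N.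
Proof.
by rewrite -[RHS](num_gen_power vd defI 1) ideal_exp1 // defI; exact: ideal_gen_ideal.
Qed.

Lemma freimanE : freiman I <-> (h 2 + 'C(r, 2) = r * h 1)%N.
Proof.
rewrite /freiman /analytic_spread (krull_dim_fiber vd defI) num_gen1 (num_gen_power vd defI).
by split; lia.
Qed.

(** In dimension zero growth leaves no monomial of positive degree, and the fiber
    cone is the base field. *)
Lemma rank0_minimal : r = 0%N -> freiman I /\ minimal_multiplicity (fiber_grading I).
Proof.
move=> r0.
have W0 k : (0 < k)%N -> W k = [::].
  case: k => // k _; apply: size0nil.
  have := hilbert_growth k.+1; have := psum_geq 0 h k.
  rewrite r0 psumS -[psum 0 h k.+1]/(size (W k.+1)) bin0 !expn0.
  by rewrite -[h 0%N]/1%N; move: (size _) (psum _ _ _); lia.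
split; first by apply/freimanE; rewrite r0 !W0.
rewrite /minimal_multiplicity /embdim (hilbert_function_fiber vd defI) W0 //.
rewrite /multiplicity (krull_dim_fiber vd defI) r0.
suff /dim_of_eq -> : is_basis [set: F] (fun _ : 'I_1 => 1) by rewrite addr0 subrr.
split=> // [c c0 i|x _].
  apply/eqP; rewrite ord1; move/eqP: c0; rewrite big_ord1 scaler_eq0 oner_eq0 orbF //.
exists (fun _ => ((fiber_poly d x)`_0)@_0%MM); rewrite big_ord1 -(fiber_mono1 vd defI).
have -> : ((fiber_poly d x)`_0)@_0%MM *: fiber_mono d I 0 0%MM = fiber_proj v d 0 x.
  by rewrite /fiber_proj big_seq1.
rewrite {1}[x](fiber_proj_sum vd defI); case sx: (size (fiber_poly d x)) => [|s].
  by rewrite big_ord0 /fiber_proj big_seq1 nth_default ?sx // mcoeff0 scale0r.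
by rewrite big_ord_recl big1 ?addr0 // => i _; rewrite /fiber_proj W0 // big_nil.
Qed.

(** Both conditions are numerical in the numerator [c] of the Hilbert series. The
    difference of the two sides is [c 2] for the Freiman condition, and the sum of
    the [c i] with [i >= 2] for minimal multiplicity. *)
Lemma h_vector_criterion c : r != 0%N -> (forall k, h k = psum r c k) ->
  (forall k, c k = 0 -> c k.+1 = 0)%N ->
  (freiman I <-> c 2 = 0%N) /\ (minimal_multiplicity (fiber_grading I) <-> c 2 = 0%N).
Proof.
move=> r0 hc cP.
have c0 : c 0%N = 1%N by rewrite -(psum_at0 r) -hc.
have [|N cN] := @psum_finite_support r c (d.+1 ^ r) cP.
  move=> k; rewrite -[psum _ _ _]/(\sum_(i < k.+1) psum r c i)%N.
  rewrite -(eq_bigr _ (fun (i : 'I_k.+1) _ => hc i)); exact: hilbert_growth.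
have r1 : (r.-1).+1 = r by rewrite prednK // lt0n.
have bin_r : (2 * 'C(r, 2) = r * r.-1)%N by rewrite -r1 -mul_bin_diag bin1.
have binSr : 'C(r.+1, 2) = ('C(r, 2) + r)%N by rewrite binS bin1.
split.
  rewrite freimanE !hc psum_at1 psum_at2 c0 binSr; move: r1 bin_r.
  move: (monomial_rank d I) (c 1%N) (c 2%N) => [|s] c1 c2 //= _; move: 'C(s.+1, 2) => A.
  by split; nia.
have dimF : krull_dim F = r.-1.+1 by rewrite (krull_dim_fiber vd defI) r1.
(* [N.+2] instead of [N], so that [c 1] and [c 2] can be split off the sum. *)
have cN2 i : (N.+2 < i)%N -> c i = 0%N by move=> Ni; apply: cN; lia.
rewrite /minimal_multiplicity /embdim (multiplicity_psum dimF _ cN2) ?c0 // => [|k]; last first.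
  by rewrite (hilbert_function_fiber vd defI) hc r1.
rewrite (hilbert_function_fiber vd defI) hc psum_at1 c0 muln1 dimF r1.
have -> : (\sum_(i < N.+3) c i = 1 + (c 1 + (c 2 + \sum_(i < N) c i.+3)))%N.
  by rewrite !big_ord_recl c0.
have natE x y : ((x%:R = y%:R - 1 :> rat) <-> (x + 1 = y)%N).
  split=> [/eqP|<-]; last by rewrite natrD addrK.
  by rewrite eq_sym subr_eq -(natrD _ x 1) Num.Theory.eqr_nat => /eqP.
rewrite -natrD natE; split=> [|c2].
  by move: (c 1%N) (c 2%N) (monomial_rank d I) (\sum_(i < N) _)%N; lia.
rewrite c2 big1 => [|i _]; first by move: (c 1%N) (monomial_rank d I); lia.
by elim: (i : nat) => [|j IHj]; apply: cP.
Qed.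

End Main.

Theorem proposition1p3 (K : fieldType) (n : nat) (I : set {mpoly K[n]})
    (Imon : monomial_ideal I) (Iequi : equigenerated I) :
  (cohen_macaulay (fiber_grading I) ->
     (freiman I <-> minimal_multiplicity (fiber_grading I))) /\
  (quadric_hypersurface (fiber_grading I) ->
     freiman I /\ minimal_multiplicity (fiber_grading I)).
Proof.
have [v [d [vd defI]]] := equigenerated_monomials Imon Iequi.
pose r := monomial_rank d I; pose h k := size (sums v k).
have dimF : krull_dim (fiber_cone I) = r := krull_dim_fiber vd defI.
have [r0|r0] := eqVneq r 0%N.
  by have [fI mI] := rank0_minimal vd defI r0.
split=> [CM|[[|e] [q iso]]].
- have dep : depth (fiber_grading I) = r by rewrite CM.
  have r1 : r = r.-1.+1 by rewrite prednK // lt0n.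
  rewrite {1}r1 in dep; have [xs [sxs xsI xsR]] := nat_max_pos dep.
  have xsa : {in xs, forall f, ideal_gen [set` fiber_gens v d I] f}.
    by move=> f fxs; apply: (irrelevant_gens vd defI); exact: xsI.
  have := generic_depth_regular_sequence xsa xsR; rewrite sxs -r1 ideal_gen_nil => gd.
  have G := fiber_standard_graded vd defI.
  have [||c [hc cP]] := generic_depth_hilbert G _ _ (fiber_has_rank vd defI) gd.
  + exact: zero_ideal_ideal.
  + by move=> x k ->; exact: (gr_0 (gr_proj G)).
  by have [-> ->] := h_vector_criterion vd defI r0 hc cP.
- by case: (quadric_ord0 q).
have hq k : h k = psum e quadric_h k.
  have [w wB] := hilbert_function_quadric q k.
  by rewrite /h -(hilbert_function_fiber vd defI) (graded_iso_basis iso wB).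
have quadric_h2 i : (1 < i)%N -> quadric_h i = 0%N by case: i => [|[|i]].
have filtE k : size (filtration (fiber_monos v d I) k) = psum e.+1 quadric_h k.
  by rewrite size_filtration_psum; apply: eq_bigr => i _; exact: hq.
have er : e = r.
  apply/eqP; rewrite eqn_leq; apply/andP; split.
    apply: (@leq_exponent (e`! * d.+1 ^ r)) => k; rewrite -mulnA.
    apply: leq_trans (expn_leq_bin _ _) _; rewrite leq_mul //.
    apply: leq_trans (hilbert_growth vd defI k); rewrite -(size_filtration_psum v d I) filtE.
    by apply: leq_trans (psum_geq _ _ _); rewrite mul1n.
  have [Q Qc] := fiber_prime_chain vd defI.
  apply: (prime_chain_growth (fiber_monos_one vd defI) (fiber_monos_mul vd defI)
    (fiber_monos_span vd defI) _ Qc) => k; rewrite filtE; exact: (psum_leq _ _ quadric_h2).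
have [|||[_ fI] [_ mI]] := @h_vector_criterion _ _ _ _ vd _ defI quadric_h.
- exact: r0.
- by move=> k; rewrite -/r -er; exact: hq.
- by case=> [|[|k]].
by split; [exact: fI | exact: mI].
Qed.
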